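(* Let $f\in\dot V_p^k$ and let $s:=d/p$ be the smoothness of $\dot V_p^k$. Then the following is true. (a) If $d=1$, then $f$ has one-sided limits at each $x\in[0,1]$. (b) If $d\ge 2$, then $f$ has a limit at each point $x\in Q^d$. In both cases, $f$ has an at most countable set of discontinuity points. (c) If $s>k$, then the vector space $\dot V_p^k$ is the direct sum of its subspaces $\ell_p$ and $\mathcal P_{k-1}^d$.
   Context: Fix $d,k\in\mathbb N$, $1\le p<\infty$, and let $Q^d:=[0,1]^d$. A cube is a closed cube in $\mathbb R^d$ homothetic to $Q^d$. A packing is a family of cubes with pairwise disjoint interiors; $\Pi$ is the set of finite packings consisting of cubes contained in $Q^d$. $\mathcal P_{k-1}^d$ is the space of real polynomials on $\mathbb R^d$ of degree at most $k-1$ (also regarded, by restriction, as functions on $Q^d$). $\ell_\infty(Q^d)$ is the space of all bounded functions $f:Q^d\to\mathbb R$ (no measurability or identification a.e.), and $\ell_p=\ell_p(Q^d)$ is the space of all $f:Q^d\to\mathbb R$ with $\|f\|_p:=(\sum_{x\in Q^d}|f(x)|^p)^{1/p}<\infty$. For a cube $Q\subset Q^d$, $E_k(f;Q):=\inf_{m\in\mathcal P_{k-1}^d}\sup_Q|f-m|$. The space $\dot V_p^k$ consists of all $f\in\ell_\infty(Q^d)$ such that $$|f|_{V_p^k}:=\sup_{\pi\in\Pi}\Big(\sum_{Q\in\pi}E_k(f;Q)^p\Big)^{1/p}<\infty.$$ Limits of $f$ at $x$ are over $y\to x$, $y\in Q^d\setminus\{x\}$. *)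

(* Defs.v *)
From HB Require Import structures.
From mathcomp Require Import all_boot all_order all_algebra.
From mathcomp Require Import all_classical all_reals all_analysis.
(* Importing all of mpoly would clash with the notations of the analysis
   library. *)
From mathcomp Require Import (canonicals, coercions) mpoly.
Import Order.TTheory GRing.Theory Num.Theory.
Import numFieldNormedType.Exports.

Set Implicit Arguments.
Unset Strict Implicit.
Unset Printing Implicit Defensive.

Local Open Scope classical_set_scope.
Local Open Scope ring_scope.

Definition unit_cube (R : realType) (d : nat) : set 'rV[R]_d :=
  [set x | forall i, 0 <= x ord0 i <= 1].

(* The points of the unit cube as a type, carrying the subspace topology;
   [set_val] is the inclusion into ['rV[R]_d]. *)
Notation cube_pt R d := (set_type (@unit_cube R d)).

(* Homothetic images of the unit cube; [0 < r] excludes single points. *)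
Definition is_cube (R : realType) (d : nat) (Q : set 'rV[R]_d) : Prop :=
  exists (a : 'rV[R]_d) (r : R),
    0 < r /\ Q = [set a + r *: x | x in @unit_cube R d].

Definition finite_packing (R : realType) (d : nat)
    (pi : set (set 'rV[R]_d)) : Prop :=
  [/\ finite_set pi,
      forall Q, pi Q -> is_cube Q /\ Q `<=` @unit_cube R d
    & trivIset pi (fun Q => Q°)].

(* [mpoly.msize m] is [deg m + 1], and is [0] for [m = 0], so the condition says
   that [m] has total degree at most [k - 1]. *)
Definition poly_space (R : realType) (d k : nat) : set (mpoly.mpoly d R) :=
  [set m | (mpoly.msize m <= k)%N].

Definition peval (R : realType) (d : nat) (m : mpoly.mpoly d R)
    (x : 'rV[R]_d) : R :=
  mpoly.meval (fun i => x ord0 i) m.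

Definition polynomial_funs (R : realType) (d k : nat) : set (cube_pt R d -> R) :=
  [set (fun x => peval m (set_val x)) | m in @poly_space R d k].

Definition approx_error (R : realType) (d k : nat) (f : cube_pt R d -> R)
    (Q : set 'rV[R]_d) : \bar R :=
  ereal_inf [set
    ereal_sup [set `|f x - peval m (set_val x)|%:E
               | x in [set x : cube_pt R d | Q (set_val x)]]
    | m in @poly_space R d k].

Definition V_seminorm (R : realType) (d k : nat) (p : R)
    (f : cube_pt R d -> R) : \bar R :=
  ereal_sup [set
    ((\sum_(Q \in pi) approx_error k f Q `^ p) `^ p^-1)%E
    | pi in @finite_packing R d].

Definition V_space (R : realType) (d k : nat) (p : R) : set (cube_pt R d -> R) :=
  [set f | bounded_fun f /\ (V_seminorm k p f < +oo)%E].

Definition lp_norm (R : realType) (d : nat) (p : R) (f : cube_pt R d -> R) :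
    \bar R :=
  ((\esum_(x in [set: cube_pt R d]) (`|f x| `^ p)%:E) `^ p^-1)%E.

Definition lp_space (R : realType) (d : nat) (p : R) : set (cube_pt R d -> R) :=
  [set f | (lp_norm p f < +oo)%E].

(* Meant for [d = 1], where the coordinatewise strict orders are the strict
   order of the interval. At an endpoint of the interval one of the two
   filters is trivial, and the existence of that limit holds vacuously. *)
Definition has_left_limit (R : realType) (d : nat) (f : cube_pt R d -> R)
    (x : cube_pt R d) : Prop :=
  exists l : R,
    f @ within [set y : cube_pt R d |
          forall i, set_val y ord0 i < set_val x ord0 i] (nbhs x) --> l.

Definition has_right_limit (R : realType) (d : nat) (f : cube_pt R d -> R)
    (x : cube_pt R d) : Prop :=
  exists l : R,
    f @ within [set y : cube_pt R d |
          forall i, set_val x ord0 i < set_val y ord0 i] (nbhs x) --> l.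

Definition has_limit (R : realType) (d : nat) (f : cube_pt R d -> R)
    (x : cube_pt R d) : Prop :=
  exists l : R, f y @[y --> x^'] --> l.

Definition discontinuities (R : realType) (d : nat) (f : cube_pt R d -> R) :
    set (cube_pt R d) :=
  [set x | ~ {for x, continuous f}].

Definition is_direct_sum (R : realType) (E : lmodType R) (V A B : set E) : Prop :=
  [/\ submod_closed (mem V), submod_closed (mem A), submod_closed (mem B),
      V = [set a + b | a in A & b in B]
    & A `&` B = [set 0]].

(* Main.v *)
Require Import Defs.
From mathcomp Require Import all_boot all_order all_algebra.
From mathcomp Require Import all_classical all_reals all_analysis.
From mathcomp Require Import zify ring lra.
From mathcomp Require Import (canonicals, coercions) mpoly.
Import Order.TTheory GRing.Theory Num.Theory.
Import numFieldNormedType.Exports.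

Set Implicit Arguments.
Unset Strict Implicit.
Unset Printing Implicit Defensive.

Local Open Scope classical_set_scope.
Local Open Scope ring_scope.

(** Why the theorem holds.

    The proofs of existence of limits and of countability rest on one fact: a
    polynomial of degree less than [k] bounded by [B] on a cube of side [r] is
    Lipschitz there with a constant of order [B / r] ([peval_lip_box]). Hence, if
    two points of a cube are close to each other compared with its side and the
    values at them of the bounded function [f] differ by [eps], the approximation
    error of [f] on the cube is at least [eps / 4] ([oscillation_lower_bound]).
    Since the [p]-th powers of the errors over a packing have bounded sums, only
    boundedly many nonoverlapping cubes can have this property.

    Applied to small disjoint cubes around points where [f] oscillates by at
    least [eps], this shows that there are finitely many such points for each
    [eps], hence countably many discontinuities ([oscillation_points_bound]).
    Applied to cubes that lie on one side of a coordinate hyperplane through [x]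
    and approach [x], it shows that [f] has a limit at [x] along each of the
    [2 d] open coordinate half spaces at [x] ([half_space_cauchy]). For [d = 1]
    these are the one-sided limits. For [d >= 2] two half spaces whose normals are
    different coordinate axes meet arbitrarily close to [x], so all these limits
    agree ([punctured_limit]).

    Now let [d / p > k], which forces [d >= 2], and let [g] be the limit
    function of [f]. It is continuous, its errors are at most those of [f], and
    [|f x - g x| / 2] is at most the error of [f] on any cube containing [x]; so
    [f - g] is in [l_p] ([sum_jumps_le]). It remains to see that [g] is a
    polynomial of degree less than [k]. A [k]-th difference of [g] with fixed step
    [H] is a sum of [L ^ k] differences with step [h = H / L]. Each of those is
    at most [2 ^ k] times the error on a cube of side [k h], and averaging over
    [n ^ d] translates of it by multiples of [k h], with [n] proportional to
    [L], gives [O (n ^ (- d / p))] because the translated cubes form a packing. The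
    total [O (n ^ (k - d / p))] tends to zero, so the difference with step [H]
    vanishes ([fdiff_eq0_of_variation]). Therefore [g] agrees on every fine grid
    with its Newton interpolation polynomial, these polynomials coincide, and
    [g] equals them by continuity ([polynomial_of_variation]).

    Conversely, for [a] in [l_p] and a polynomial [m], the error of [a + m] on a
    cube is at most twice [|a|] at some point of the cube, and a point belongs to
    at most [2 ^ d] cubes of a packing ([sum_packing_le]), whence
    [a + m] has finite variation. Finally a polynomial which is not zero
    on the cube stays away from zero at infinitely many points, so it is not
    in [l_p] ([lp_polynomial_eq0]). *)

(** * Lipschitz bounds for univariate polynomials *)

Lemma size_prod_exp_le (R : realType) (I : finType) (F : I -> {poly R})
    (c : I -> nat) :
  (forall i, size (F i) <= 2)%N ->
  (size (\prod_i F i ^+ c i)%R <= (\sum_i c i).+1)%N.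
Proof.
move=> F2; elim/big_rec2: _ => [|i n q _ IH]; first by rewrite size_poly1.
apply: (leq_trans (size_polyMleq _ _)).
have : (size (F i ^+ c i)%R <= (c i).+1)%N.
  elim: (c i) => [|e IHe]; first by rewrite expr0 size_poly1.
  rewrite exprS; apply: (leq_trans (size_polyMleq _ _)).
  by have := F2 i; lia.
by lia.
Qed.

(** Multivariate statements are reduced to [{poly R}] by restriction to lines. *)
Lemma peval_line (R : realType) (d : nat) (m : mpoly.mpoly d R)
    (x v : 'rV[R]_d) :
  exists2 q : {poly R}, (size q <= mpoly.msize m)%N
    & forall t, q.[t] = peval m (x + t *: v).
Proof.
exists (\sum_(c <- mpoly.msupp m) mpoly.mcoeff c m *:
    \prod_i ((x ord0 i)%:P + v ord0 i *: 'X) ^+ c i).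
  apply: (leq_trans (size_sum _ _ _)).
  apply/bigmax_leqP_seq => c cm _.
  apply: (leq_trans (size_scale_leq _ _)).
  apply: (leq_trans _ (mpoly.msize_mdeg_lt cm)).
  rewrite mpoly.mdegE; apply: size_prod_exp_le => i.
  rewrite (leq_trans (size_polyD _ _))// geq_max size_polyC.
  rewrite (leq_trans (size_scale_leq _ _)) ?size_polyX// andbT.
  by case: (_ != _).
move=> t; rewrite /peval mpoly.mevalE horner_sum.
apply: eq_bigr => c _; rewrite hornerZ horner_prod; congr (_ * _).
by apply: eq_bigr => i _; rewrite horner_exp !hornerE !mxE; congr (_ ^+ _); ring.
Qed.

Lemma horner_lip (R : realType) (q : {poly R}) :
  exists2 K : R, 0 <= K & forall s t, 0 <= s <= 1 -> 0 <= t <= 1 ->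
    `|q.[s]| <= K /\ `|q.[s] - q.[t]| <= K * `|s - t|.
Proof.
elim/poly_ind: q => [|q c [K K0 IH]].
  by exists 0 => // s t _ _; rewrite !horner0 subrr normr0 mul0r.
exists (K + K + `|c|) => [|s t s01 t01].
  by rewrite !addr_ge0.
have [qs qst] := IH s t s01 t01.
rewrite !hornerMXaddC; split.
  apply: (le_trans (ler_normD _ _)); rewrite lerD2r normrM.
  have s1 : `|s| <= 1 by rewrite ger0_norm; lra.
  have := normr_ge0 s; have := normr_ge0 q.[s]; nra.
have -> : q.[s] * s + c - (q.[t] * t + c) =
    q.[s] * (s - t) + t * (q.[s] - q.[t]) by ring.
apply: (le_trans (ler_normD _ _)); rewrite !normrM !mulrDl.
have t1 : `|t| <= 1 by rewrite ger0_norm; lra.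
rewrite -addrA lerD ?ler_wpM2r//.
rewrite -[X in X <= _]addr0 lerD ?mulr_ge0//.
have := normr_ge0 t; have := normr_ge0 (q.[s] - q.[t]); nra.
Qed.

(** Lagrange interpolation at the nodes [0, 1/k, ..., (k-1)/k] writes [q] as a
    combination, with coefficients bounded by [B], of [k] fixed Lipschitz
    polynomials; the constant is the sum of theirs. *)
Lemma horner_lip_uniform (R : realType) (k : nat) : (0 < k)%N ->
  exists2 K : R, 0 <= K & forall (q : {poly R}) (B : R), (size q <= k)%N ->
    (forall t, 0 <= t <= 1 -> `|q.[t]| <= B) ->
    forall s t, 0 <= s <= 1 -> 0 <= t <= 1 ->
      `|q.[s] - q.[t]| <= K * B * `|s - t|.
Proof.
move=> k0; pose nd (i : nat) : R := i%:R / k%:R.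
have nd_inj : injective nd.
  move=> i j /(congr1 (fun z => z * k%:R)).
  by rewrite !divfK ?pnatr_eq0 -?lt0n// => /eqP; rewrite eqr_nat => /eqP.
have lip (i : 'I_k) := horner_lip (tnth (lagrange k nd) i).
pose K (i : 'I_k) : R := sval (cid2 (lip i)).
have K0 i : 0 <= K i by rewrite /K; case: cid2.
exists (\sum_i K i) => [|q B qk qB s t s01 t01]; first exact: sumr_ge0.
have -> : q = \sum_(i < k) q.[nd i]%:P * tnth (lagrange k nd) i.
  exact: lagrange_gen.
rewrite !horner_sum -sumrB.
apply: (le_trans (ler_norm_sum _ _ _)); rewrite !mulr_suml.
apply: ler_sum => i _; rewrite !hornerM !hornerC -mulrBr normrM.
have ndi : `|q.[nd i]| <= B.
  apply: qB; rewrite /nd divr_ge0//= ler_pdivrMr ?ltr0n// mul1r ler_nat.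
  exact: ltnW.
rewrite [K i * B]mulrC -mulrA ler_pM//.
by rewrite /K; case: cid2 => C /= C0 /(_ s t s01 t01)[_].
Qed.

(** * Boxes and lower bounds for the approximation error *)

Definition box (R : realType) (d : nat) (a : 'rV[R]_d) (r : R) :
    set 'rV[R]_d :=
  [set x | forall i, a ord0 i <= x ord0 i <= a ord0 i + r].

(** Bounding the error of best approximation from below, without mentioning
    the extended-real infimum and supremum that define it. *)
Definition error_lower_bound (R : realType) (d k : nat) (F : 'rV[R]_d -> R)
    (Q : set 'rV[R]_d) (e : R) : Prop :=
  forall m, @poly_space R d k m -> forall B,
    (forall x, Q x -> `|F x - peval m x| <= B) -> e <= B.

Definition nonoverlapping (R : realType) (d : nat) (a : 'rV[R]_d) (r : R)
    (b : 'rV[R]_d) (s : R) : Prop :=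
  exists i, a ord0 i + r <= b ord0 i \/ b ord0 i + s <= a ord0 i.

(** The packing condition with the [p]-th powers of the errors replaced by those
    of arbitrary lower bounds for them; it passes from [F] to any function whose
    errors are smaller. *)
Definition cube_variation_le (R : realType) (d k : nat) (p C : R)
    (F : 'rV[R]_d -> R) : Prop :=
  forall (I : finType) (a : I -> 'rV[R]_d) (r e : I -> R),
    (forall i, 0 < r i) ->
    (forall i, box (a i) (r i) `<=` @unit_cube R d) ->
    (forall i j, i != j -> nonoverlapping (a i) (r i) (a j) (r j)) ->
    (forall i, 0 <= e i) ->
    (forall i, error_lower_bound k F (box (a i) (r i)) (e i)) ->
    \sum_i e i `^ p <= C.

(** The coordinates are changed one at a time: a line parallel to an axis meets
    the box in a segment of length [r], whereas the chord through two
    points can be arbitrarily short, which would spoil the constant. *)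
Lemma peval_lip_box (R : realType) (d k : nat) : (0 < k)%N ->
  exists2 K : R, 0 <= K & forall m, @poly_space R d k m ->
    forall (a : 'rV[R]_d) (r B : R), 0 < r ->
    (forall x, box a r x -> `|peval m x| <= B) ->
    forall (y z : 'rV[R]_d) (delta : R), box a r y -> box a r z ->
    (forall i, `|y ord0 i - z ord0 i| <= delta) ->
    `|peval m y - peval m z| <= K * B * (delta / r).
Proof.
move=> k0; have [K K0 HK] := @horner_lip_uniform R k k0.
exists (d%:R * K) => [|m mk a r B r0 mB y z delta ya za yz].
  by rewrite mulr_ge0.
have B0 : 0 <= B by apply: le_trans (mB _ ya).
pose w (j : nat) : 'rV[R]_d :=
  \row_i (if (i < j)%N then z ord0 i else y ord0 i).
have w0 : w 0%N = y by apply/rowP => i; rewrite mxE ltn0.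
have wd : w d = z by apply/rowP => i; rewrite mxE ltn_ord.
have wbox j : box a r (w j) by move=> i; rewrite mxE; case: ifP.
suff H j : (j <= d)%N ->
    `|peval m y - peval m (w j)| <= j%:R * K * B * (delta / r).
  by rewrite -wd; exact: H.
elim: j => [_|j IH jd].
  by rewrite w0 subrr normr0 !mul0r.
rewrite -(subrKA (peval m (w j))) (le_trans (ler_normD _ _))//.
rewrite -natr1 !mulrDl mul1r lerD ?IH 1?ltnW//.
pose i0 := Ordinal jd.
pose x : 'rV[R]_d :=
  \row_i (if i == i0 then a ord0 i0 else w j ord0 i).
have [q qk qE] := peval_line m x (r *: delta_mx ord0 i0).
have coord t i : (x + t *: (r *: delta_mx ord0 i0)) ord0 i =
    if i == i0 then a ord0 i0 + t * r else w j ord0 i.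
  by rewrite !mxE eqxx /=; case: ifP => _; rewrite ?mulr1 ?mulr0 ?addr0.
have qB t : 0 <= t <= 1 -> `|q.[t]| <= B.
  move=> t01; rewrite qE; apply: mB => i; rewrite coord.
  by case: ifP => [/eqP ->|_]; [nra|exact: wbox].
pose sy := (y ord0 i0 - a ord0 i0) / r.
pose sz := (z ord0 i0 - a ord0 i0) / r.
have s01 u : box a r u -> 0 <= (u ord0 i0 - a ord0 i0) / r <= 1.
  move=> /(_ i0) ub; rewrite divr_ge0 ?ler_pdivrMr//; lra.
have -> : w j = x + sy *: (r *: delta_mx ord0 i0).
  apply/rowP => i; rewrite coord /sy divfK ?(gt_eqF r0)//.
  by case: (eqVneq i i0) => // ->; rewrite mxE /= ltnn; ring.
have -> : w j.+1 = x + sz *: (r *: delta_mx ord0 i0).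
  apply/rowP => i; rewrite coord /sz divfK ?(gt_eqF r0)//.
  case: (eqVneq i i0) => [->|ii]; first by rewrite mxE /= leqnn; ring.
  rewrite !mxE ltnS leq_eqVlt; case: (eqVneq (i : nat) j) => // ij.
  by case/eqP: ii; apply: val_inj.
rewrite -!qE.
apply: (le_trans (HK q B (leq_trans qk mk) qB _ _ (s01 _ ya) (s01 _ za))).
apply: ler_wpM2l; first exact: mulr_ge0.
have -> : sy - sz = (y ord0 i0 - z ord0 i0) / r by rewrite /sy /sz; ring.
rewrite normrM.
by rewrite [X in _ * X <= _]gtr0_norm ?invr_gt0// ler_pM2r ?invr_gt0.
Qed.

(** A polynomial within [eps/4] of [F] is bounded in terms of [M] and [eps],
    hence varies by less than [eps/2] between two points at a small distance
    relative to the side of the box. *)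
Lemma oscillation_lower_bound (R : realType) (d k : nat) (M eps : R) :
  (0 < k)%N -> 0 < eps ->
  exists2 delta : R, 0 < delta & forall (F : 'rV[R]_d -> R) a r, 0 < r ->
    (forall x, box a r x -> `|F x| <= M) ->
    forall y z : 'rV[R]_d, box a r y -> box a r z ->
    (forall i, `|y ord0 i - z ord0 i| <= delta * r) ->
    eps <= `|F y - F z| -> error_lower_bound k F (box a r) (eps / 4).
Proof.
move=> k0 e0; have [K K0 HK] := @peval_lip_box R d k k0.
have KM0 : 0 <= K * (`|M| + eps) by rewrite mulr_ge0// addr_ge0// ltW.
exists (eps / (2 * (K * (`|M| + eps) + 1))).
  by rewrite divr_gt0// mulr_gt0// ltr_wpDl.
move=> F a r r0 FM y z ya za yz Fyz m mk B HB.
rewrite leNgt; apply/negP => Be.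
have mB x : box a r x -> `|peval m x| <= `|M| + eps.
  move=> xa; have := HB x xa; have := FM x xa; have := ler_norm M.
  have := lerB_dist (peval m x) (F x); rewrite (distrC (peval m x)).
  lra.
have := HK m mk a r _ r0 mB y z _ ya za yz.
rewrite mulfK ?gt_eqF// => H.
have {}H : `|peval m y - peval m z| <= eps / 2.
  apply: (le_trans H); rewrite mulrA ler_pdivrMr ?mulr_gt0 ?ltr_wpDl//.
  by rewrite mulrA divfK// [X in X <= _]mulrC ler_wpM2l ?lerDl// ltW.
have := HB y ya; have := HB z za; move: Fyz.
have -> : F y - F z = (F y - peval m y) + (peval m y - peval m z)
   - (F z - peval m z) by ring.
have := ler_normB ((F y - peval m y) + (peval m y - peval m z)) (F z - peval m z).
have := ler_normD (F y - peval m y) (peval m y - peval m z).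
lra.
Qed.

(** * Nonoverlapping boxes around points and next to a point *)

(** The side of the next box in [half_space_cauchy] along the distinguished
    coordinate: [rho] leaves room for the boxes to come, and the bound [2 * h]
    keeps the box apart from the previous ones. *)
Lemma side_interval (R : realType) (s x y z h : R) : s = 1 \/ s = -1 ->
  0 < h -> 0 <= x + s * (2 * h) <= 1 ->
  0 <= x <= 1 -> 0 <= y <= 1 -> 0 <= z <= 1 ->
  0 < s * (y - x) -> 0 < s * (z - x) ->
  `|y - x| <= h / 2 -> `|z - x| <= h / 2 ->
  exists u rho : R, [/\ 0 <= u /\ u + h <= 1, u <= y <= u + h, u <= z <= u + h,
    0 < rho & rho <= s * (u - x) <= 2 * h /\ rho <= s * (u + h - x) <= 2 * h].
Proof.
move=> s1 h0 room x01 y01 z01 sy sz.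
rewrite !ler_norml => yh zh.
wlog yz : y z y01 z01 sy sz yh zh / y <= z.
  move=> W; case: (leP y z) => [|/ltW] yz; first exact: (W y z).
  by have [u [rho [? ? ? ? ?]]] := W z y z01 y01 sz sy zh yh yz; exists u, rho.
case: s1 => ?; subst s.
  by exists y, (y - x); split; (try split); lra.
by exists (z - h), (x - z); split; (try split); lra.
Qed.

(** The interval [[corner h x, corner h x + h]] is centred at [x] but pushed
    back into the unit interval; what [h / 2] guarantees is that it contains all
    the points of the unit interval near [x]. *)
Definition corner (R : realType) (h x : R) : R :=
  Num.max 0 (Num.min (x - h / 2) (1 - h)).

Lemma corner_ge0 (R : realType) (h x : R) : 0 <= corner h x.
Proof. by rewrite le_max lexx. Qed.

Lemma corner_le1 (R : realType) (h x : R) : h <= 1 -> corner h x + h <= 1.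
Proof.
by rewrite /corner => h1; case: (lerP (x - h / 2) (1 - h)) => ?; case: (lerP 0) => *; lra.
Qed.

Lemma corner_near (R : realType) (h x y : R) : h <= 1 -> 0 <= y <= 1 ->
  `|y - x| <= h / 2 -> corner h x <= y <= corner h x + h.
Proof.
rewrite /corner ler_norml => h1 y01 yx.
by case: (lerP (x - h / 2) (1 - h)) => ?; case: (lerP 0) => *; apply/andP; split; lra.
Qed.

Definition corner_box (R : realType) (d : nat) (h : R) (x : 'rV[R]_d) :
  'rV[R]_d := \row_i corner h (x ord0 i).

Lemma corner_box_sub (R : realType) (d : nat) (h : R) (x : 'rV[R]_d) :
  0 <= h <= 1 -> box (corner_box h x) h `<=` @unit_cube R d.
Proof.
move=> h01 y yb i; have := yb i; rewrite mxE.
have := corner_ge0 h (x ord0 i).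
have : corner h (x ord0 i) + h <= 1 by apply: corner_le1; lra.
lra.
Qed.

Lemma corner_box_near (R : realType) (d : nat) (h : R) (x y : 'rV[R]_d) :
  h <= 1 -> unit_cube y -> (forall i, `|y ord0 i - x ord0 i| <= h / 2) ->
  box (corner_box h x) h y.
Proof. by move=> h1 yu yx i; rewrite mxE corner_near. Qed.

Lemma corner_box_mem (R : realType) (d : nat) (h : R) (x : 'rV[R]_d) :
  0 <= h <= 1 -> unit_cube x -> box (corner_box h x) h x.
Proof.
move=> h01 xu; apply: corner_box_near => //; first lra.
by move=> i; rewrite subrr normr0; lra.
Qed.

Lemma finite_pos_lbound (R : realType) (T : finType) (f : T -> R) :
  (forall t, 0 < f t) -> exists m : R, [/\ 0 < m, m <= 1 & forall t, m <= f t].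
Proof.
move=> f0; exists (\big[Num.min/1]_t f t); split.
- by elim/big_ind: _ => // x y x0 y0; rewrite lt_min x0.
- by elim/big_rec: _ => [|t x _ x1]; rewrite ?ge_min ?x1 ?orbT.
- by move=> t; rewrite (bigD1 t)//= ge_min lexx.
Qed.

Lemma separated_corner_boxes (R : realType) (d : nat) (I : finType)
    (x : I -> 'rV[R]_d) : injective x -> (forall i, unit_cube (x i)) ->
  exists2 h0 : R, 0 < h0 <= 1 & forall h, 0 < h <= h0 -> forall i j, i != j ->
    nonoverlapping (corner_box h (x i)) h (corner_box h (x j)) h.
Proof.
move=> xI xu.
have sep (ij : I * I) : exists g : R, 0 < g /\ (ij.1 != ij.2 ->
    exists c, g <= `|x ij.1 ord0 c - x ij.2 ord0 c|).
  case: ij => i j /=; case: (eqVneq i j) => [_|ij]; first by exists 1.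
  have /existsP[c xc] : [exists c, x i ord0 c != x j ord0 c].
    apply: contraNT ij; rewrite negb_exists => /forallP H.
    by apply/eqP/xI/rowP => c; have := H c; rewrite negbK => /eqP.
  exists `|x i ord0 c - x j ord0 c|; split; last by exists c.
  by rewrite normr_gt0 subr_eq0.
pose g ij := sval (cid (sep ij)).
have gP ij := svalP (cid (sep ij)).
have [m [m0 m1 mg]] := @finite_pos_lbound R (I * I)%type g (fun ij => (gP ij).1).
exists (m / 2); first by lra.
move=> h hm i j ij; have [c xc] := (gP (i, j)).2 ij.
have {}xc : 2 * h <= `|x i ord0 c - x j ord0 c|.
  by apply: le_trans xc; have := mg (i, j); rewrite /g; lra.
have crn k : x k ord0 c - h <= corner h (x k ord0 c) <= x k ord0 c.
  have : corner h (x k ord0 c) <= x k ord0 c <= corner h (x k ord0 c) + h.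
    apply: corner_near; [lra|exact: xu|].
    by rewrite subrr normr0; lra.
  lra.
have := crn i; have := crn j.
exists c; rewrite !mxE; move: xc; case: ler0P => *; [left|right]; lra.
Qed.

(** Pairwise nonoverlapping boxes around the points [x i] all have error at least
    [eps / 4], however small they are, because [F] oscillates by [eps]
    at each [x i] within a distance that is small compared with their side. *)
Lemma oscillation_points_bound (R : realType) (d k : nat) (p C M eps : R)
    (F : 'rV[R]_d -> R) : (0 < k)%N -> cube_variation_le k p C F ->
  (forall x, unit_cube x -> `|F x| <= M) -> 0 < eps ->
  forall (I : finType) (x : I -> 'rV[R]_d), injective x ->
  (forall i, unit_cube (x i)) ->
  (forall i (delta : R), 0 < delta -> exists y, [/\ unit_cube y,
     forall j, `|y ord0 j - x i ord0 j| <= delta & eps <= `|F y - F (x i)|]) ->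
  #|I|%:R * (eps / 4) `^ p <= C.
Proof.
move=> k0 FC FM e0 I x xI xu xosc.
have [delta delta0 osc] := @oscillation_lower_bound R d k M eps k0 e0.
have [h h01 sep] := separated_corner_boxes xI xu.
have hh : 0 <= h <= 1 by lra.
rewrite mulr_natl -sumr_const.
apply: (FC I (fun i => corner_box h (x i)) (fun=> h) (fun=> eps / 4)).
- by move=> i; lra.
- by move=> i; exact: corner_box_sub.
- by apply: sep; lra.
- by move=> i; lra.
move=> i; pose dl := Num.min (delta * h) (h / 2).
have dl0 : 0 < dl by rewrite lt_min mulr_gt0//=; lra.
have [y [yu yx yF]] := xosc i dl dl0.
apply: (osc F _ h _ _ y (x i)) => //.
- by lra.
- by move=> z zb; apply: FM; apply: corner_box_sub zb.
- apply: corner_box_near => //; first lra.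
  by move=> j; apply: le_trans (yx j) _; rewrite ge_min lexx orbT.
- exact: corner_box_mem.
- by move=> j; apply: le_trans (yx j) _; rewrite ge_min lexx.
Qed.

(** Were the oscillation of [F] on the half space [s * (y i - x i) > 0] at
    least [eps] arbitrarily close to [x], cubes lying in that half space, and
    so avoiding [x], could be chosen one after the other, each of them
    closer to [x] than the previous ones and with a pair of relatively close
    points witnessing the oscillation. *)
Lemma half_space_cauchy (R : realType) (d k : nat) (p C M : R)
    (F : 'rV[R]_d -> R) (x : 'rV[R]_d) (i : 'I_d) (s eps : R) : (0 < k)%N ->
  cube_variation_le k p C F -> (forall x, unit_cube x -> `|F x| <= M) ->
  unit_cube x -> s = 1 \/ s = -1 -> 0 < eps ->
  exists2 delta : R, 0 < delta & forall y z, unit_cube y -> unit_cube z ->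
    (forall j, `|y ord0 j - x ord0 j| < delta) ->
    (forall j, `|z ord0 j - x ord0 j| < delta) ->
    0 < s * (y ord0 i - x ord0 i) -> 0 < s * (z ord0 i - x ord0 i) ->
    `|F y - F z| < eps.
Proof.
move=> k0 FC FM xu s1 e0; apply: contrapT => nC.
have bad (t : R) : 0 < t -> exists y z, [/\ unit_cube y /\ unit_cube z,
    forall j, `|y ord0 j - x ord0 j| < t, forall j, `|z ord0 j - x ord0 j| < t,
    0 < s * (y ord0 i - x ord0 i) /\ 0 < s * (z ord0 i - x ord0 i)
    & eps <= `|F y - F z|].
  move=> t0; apply: contrapT => nb; apply: nC; exists t => // y z yu zu yx zx sy sz.
  by rewrite ltNge; apply/negP => H; apply: nb; exists y, z.
have [delta delta0 osc] := @oscillation_lower_bound R d k M eps k0 e0.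
have [T T0 roomT] : exists2 T : R, 0 < T &
    forall h, 0 <= h <= T -> 0 <= x ord0 i + s * (2 * h) <= 1.
  have [y [_ [[yu _] _ _ [sy _] _]]] := bad 1 ltr01.
  exists (s * (y ord0 i - x ord0 i) / 2); first lra.
  by move=> h; have := yu i; have := xu i; case: s1 sy => -> *; lra.
(* [rho] is the distance to the hyperplane through [x] that the next box must
   not exceed *)
have fam n : exists (I : finType) (a : I -> 'rV[R]_d) (r : I -> R) (rho : R),
    [/\ #|I| = n, (forall j, 0 < r j) /\ 0 < rho,
        forall j, box (a j) (r j) `<=` @unit_cube R d /\
                  error_lower_bound k F (box (a j) (r j)) (eps / 4),
        forall j l, j != l -> nonoverlapping (a j) (r j) (a l) (r l)
      & forall j, rho <= s * (a j ord0 i - x ord0 i) /\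
                  rho <= s * (a j ord0 i + r j - x ord0 i)].
  elim: n => [|n [I [a [r [rho [cI [r0 rho0] ab sep far]]]]]].
    by exists void, (fun=> 0), (fun=> 1), 1; split => //; rewrite card_void.
  have [h [h0 h1 hT hrho]] : exists h : R, [/\ 0 < h, h <= 1, h <= T & 2 * h <= rho].
    exists (Num.min 1 (Num.min T (rho / 2))); split.
    - by rewrite !lt_min T0 ltr01; lra.
    - by rewrite ge_min lexx.
    - by rewrite !ge_min lexx !orbT.
    - have : Num.min 1 (Num.min T (rho / 2)) <= rho / 2.
        by rewrite !ge_min lexx !orbT.
      lra.
  pose dl := Num.min (delta * h / 2) (h / 2).
  have dl0 : 0 < dl by rewrite lt_min !divr_gt0 ?mulr_gt0.
  have dl1 : dl <= delta * h / 2 by rewrite ge_min lexx.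
  have dl2 : dl <= h / 2 by rewrite ge_min lexx orbT.
  have [y [z [[yu zu] yx zx [sy sz] Fyz]]] := bad dl dl0.
  have yh j : `|y ord0 j - x ord0 j| <= h / 2 by apply: le_trans (ltW (yx j)) _.
  have zh j : `|z ord0 j - x ord0 j| <= h / 2 by apply: le_trans (ltW (zx j)) _.
  have h0T : 0 <= h <= T by lra.
  have [u [rho' [[u0 u1] yu' zu' rho'0 [ux ux']]]] := side_interval s1 h0
    (roomT h h0T) (xu i) (yu i) (zu i) sy sz (yh i) (zh i).
  pose b : 'rV[R]_d := \row_j (if j == i then u else corner h (x ord0 j)).
  have bsub : box b h `<=` @unit_cube R d.
    move=> w wb j; have := wb j; rewrite mxE; case: eqP => [->|_]; first lra.
    have := corner_ge0 h (x ord0 j); have := corner_le1 (x ord0 j) h1; lra.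
  have bmem w : unit_cube w -> u <= w ord0 i <= u + h ->
      (forall j, `|w ord0 j - x ord0 j| <= h / 2) -> box b h w.
    move=> wu wi wx j; rewrite mxE; case: eqP => [->//|_].
    exact: corner_near.
  have bi : b ord0 i = u by rewrite mxE eqxx.
  have newsep j : b ord0 i + h <= a j ord0 i \/ a j ord0 i + r j <= b ord0 i.
    rewrite bi; have := far j; have := r0 j.
    by case: s1 ux ux' => -> *; [left|right]; lra.
  exists (option I : finType), (fun o => if o is Some j then a j else b),
    (fun o => if o is Some j then r j else h), (Num.min rho rho').
  split.
  - by rewrite card_option cI.
  - by split; [case|rewrite lt_min rho0].
  - case=> [j|]; first exact: ab.
    split=> //; apply: (osc F b h h0 _ y z) => //.
    + by move=> w wb; apply: FM; apply: bsub.
    + exact: bmem.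
    + exact: bmem.
    + move=> j; have := yx j; have := zx j.
      by rewrite !ltr_norml ler_norml => *; lra.
  - move=> [j|] [l|] //= jl.
    + by apply: sep.
    + by exists i; case: (newsep j); [right|left].
    + by exists i.
  - case=> [j|].
      by have [f1 f2] := far j; rewrite !ge_min f1 f2.
    by rewrite !ge_min bi; split; apply/orP; right; lra.
have E0 : 0 < (eps / 4) `^ p by apply: powR_gt0; rewrite divr_gt0.
have [n nC'] : exists n : nat, C < n%:R * (eps / 4) `^ p.
  exists (Num.Def.trunc (`|C| / (eps / 4) `^ p)).+1.
  rewrite -ltr_pdivrMr//; apply: le_lt_trans (truncnS_gt _).
  by rewrite ler_pM2r ?invr_gt0// ler_norm.
have [I [a [r [rho [cI [r0 rho0] ab sep far]]]]] := fam n.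
suff : n%:R * (eps / 4) `^ p <= C by rewrite leNgt nC'.
rewrite mulr_natl -cI -sumr_const.
apply: (FC I a r (fun=> eps / 4)) => // j; [exact: (ab j).1| |exact: (ab j).2].
by rewrite ltW// divr_gt0.
Qed.

(** * From the seminorm to finite families of boxes *)

Lemma unit_cubeP (R : realType) (d : nat) (x : 'rV[R]_d) :
  unit_cube x -> exists y : cube_pt R d, set_val y = x.
Proof. by move=> xu; exists (exist _ x (mem_set xu)); rewrite set_valE. Qed.

Lemma unit_cube_val (R : realType) (d : nat) (x : cube_pt R d) :
  unit_cube (set_val x).
Proof. by rewrite set_valE; apply: set_mem; apply: valP. Qed.

Lemma set_val_inj (R : realType) (d : nat) :
  injective (set_val : cube_pt R d -> 'rV[R]_d).
Proof. by rewrite set_valE; exact: val_inj. Qed.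

Lemma unit_cube_box (R : realType) (d : nat) : @unit_cube R d = box 0 1.
Proof.
by apply/seteqP; split=> x H i; have := H i; rewrite !mxE add0r.
Qed.

(** Differences and translates are taken in the whole space. *)
Definition zero_extension (R : realType) (d : nat) (f : cube_pt R d -> R)
    (x : 'rV[R]_d) : R :=
  if pselect (exists y : cube_pt R d, set_val y = x) is left H
  then f (projT1 (cid H)) else 0.

Lemma zero_extensionE (R : realType) (d : nat) (f : cube_pt R d -> R) y :
  zero_extension f (set_val y) = f y.
Proof.
rewrite /zero_extension; case: pselect => [H|[]]; last by exists y.
by case: cid => z /= /set_val_inj ->.
Qed.

Lemma box_image (R : realType) (d : nat) (a : 'rV[R]_d) (r : R) : 0 < r ->
  [set a + r *: x | x in @unit_cube R d] = box a r.
Proof.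
move=> r0; apply/seteqP; split=> [_ [x xu <-] i|x xb].
  by rewrite !mxE; have := xu i; nra.
exists (r^-1 *: (x - a)); last first.
  by rewrite scalerA divff ?gt_eqF// scale1r addrC subrK.
move=> i; rewrite !mxE; have := xb i => /andP[x1 x2].
by rewrite mulr_ge0 ?invr_ge0 ?subr_ge0 ?(ltW r0)//= mulrC ler_pdivrMr//; lra.
Qed.

Lemma box_is_cube (R : realType) (d : nat) (a : 'rV[R]_d) (r : R) :
  0 < r -> is_cube (box a r).
Proof. by move=> r0; exists a, r; split => //; rewrite box_image. Qed.

Lemma is_cubeP (R : realType) (d : nat) (Q : set 'rV[R]_d) : is_cube Q ->
  exists a r, 0 < r /\ Q = box a r.
Proof. by move=> [a [r [r0 ->]]]; exists a, r; rewrite box_image. Qed.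

Lemma nbhs_rowP (R : realType) (d : nat) (x : 'rV[R]_d) (A : set 'rV[R]_d) :
  nbhs x A <-> exists2 e : R, 0 < e &
    forall y : 'rV[R]_d, (forall i, `|x ord0 i - y ord0 i| < e) -> A y.
Proof.
split=> [/nbhs_ballP[e e0 eA]|[e e0 eA]].
  by exists e => // y xy; apply: eA; split => // i j; rewrite (ord1 i); exact: xy.
apply/nbhs_ballP; exists e => // y [_ xy]; apply: eA => i; exact: xy.
Qed.

(** Moving a point of the interior of a box a little in one coordinate stays
    in the box, which makes the inequalities of that coordinate strict. *)
Lemma interior_box (R : realType) (d : nat) (a : 'rV[R]_d) (r : R) x :
  (box a r)° x -> forall i, a ord0 i < x ord0 i < a ord0 i + r.
Proof.
move=> /nbhs_rowP[e e0 eb] i.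
have H (s : R) : `|s| < e -> a ord0 i <= x ord0 i + s <= a ord0 i + r.
  move=> se; have /(_ _) := eb (\row_j (x ord0 j + s)) _ i.
  by rewrite mxE; apply => j; rewrite mxE opprD addNKr normrN.
have := H (e / 2); have := H (- (e / 2)).
rewrite normrN ger0_norm; last lra.
by move=> /(_ _)/[swap]/(_ _) H1 H2; apply/andP; split;
  [have := H2|have := H1] => /(_ ltac:(lra)); lra.
Qed.

Lemma error_lower_bound_approx (R : realType) (d k : nat) (f : cube_pt R d -> R)
    (Q : set 'rV[R]_d) (e : R) : Q `<=` @unit_cube R d -> 0 <= e ->
  error_lower_bound k (zero_extension f) Q e ->
  (e%:E <= approx_error k f Q)%E.
Proof.
move=> Qu e0 He; apply/ereal_infP => _ [m mk <-].
set S := (X in ereal_sup X).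
have SP (x : cube_pt R d) : Q (set_val x) ->
    (`|f x - peval m (set_val x)|%:E <= ereal_sup S)%E.
  by move=> Qx; apply: ereal_sup_ubound; exists x.
case E : (ereal_sup S) => [B| |]; last 2 first.
- exact: leey.
- have := He m mk (-1); rewrite leNgt.
  have -> /= : -1 < e by lra.
  move=> H; suff : false by []; apply: H => x Qx.
  have [y yx] := unit_cubeP (Qu _ Qx); move: Qx; rewrite -yx => Qy.
  by have := SP y Qy; rewrite E leeNy_eq.
rewrite lee_fin; apply: (He m mk) => x Qx.
have [y yx] := unit_cubeP (Qu _ Qx); move: Qx; rewrite -yx => Qy.
by rewrite zero_extensionE; have := SP y Qy; rewrite E lee_fin.
Qed.

Lemma approx_error_ge0 (R : realType) (d k : nat) (f : cube_pt R d -> R)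
    (a : 'rV[R]_d) (r : R) : 0 < r -> box a r `<=` @unit_cube R d ->
  (0 <= approx_error k f (box a r))%E.
Proof.
move=> r0 bu; apply/ereal_infP => _ [m mk <-].
have ab : box a r a by move=> i; lra.
have [y ya] := unit_cubeP (bu a ab).
apply: (@le_trans _ _ `|f y - peval m (set_val y)|%:E); first by rewrite lee_fin.
by apply: ereal_sup_ubound; exists y => //=; rewrite ya.
Qed.

Lemma V_space_variation (R : realType) (d k : nat) (p : R)
    (f : cube_pt R d -> R) : 1 <= p -> V_space k p f ->
  exists C : R, cube_variation_le k p C (zero_extension f).
Proof.
move=> p1 [_ fV].
have p0 : 0 < p by lra.
have V0 : (0 <= V_seminorm k p f)%E.
  apply: (@le_trans _ _ ((\sum_(Q \in set0) approx_error k f Q `^ p) `^ p^-1)%E).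
    exact: poweR_ge0.
  apply: ereal_sup_ubound; exists set0 => //; split => //.
have vfin : V_seminorm k p f \is a fin_num by rewrite ge0_fin_numE.
exists (fine (V_seminorm k p f) `^ p) => I a r e r0 bu sep e0 He.
pose Q i := box (a i) (r i).
have Qinj : injective Q.
  move=> i j Qij; apply/eqP; apply: contraT => ij.
  have [c H] := sep i j ij.
  have aiQ : Q i (a i) by move=> l; have := r0 i; lra.
  have ajQ : Q j (a j) by move=> l; have := r0 j; lra.
  move: (aiQ) (ajQ); rewrite {1}Qij -{2}Qij => /(_ c) aij /(_ c) aji.
  by have := r0 i; have := r0 j; case: H; lra.
pose pi : set (set 'rV[R]_d) := [set` [seq Q i | i <- enum I]].
have piP : finite_packing pi.
  split; first exact: finite_seq.
    by move=> _ /mapP[i _ ->]; split; [exact: box_is_cube|exact: bu].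
  move=> _ _ /mapP[i _ ->] /mapP[j _ ->] [x [xi xj]].
  case: (eqVneq i j) => [->//|ij]; have [c H] := sep i j ij.
  have /andP[j1 j2] := interior_box xj c; have /andP[i1 i2] := interior_box xi c.
  exfalso; case: H => H.
    by have := lt_trans (lt_le_trans i2 H) j1; rewrite ltxx.
  by have := lt_trans (lt_le_trans j2 H) i1; rewrite ltxx.
have piV : ((\sum_(S \in pi) approx_error k f S `^ p) `^ p^-1 <=
    V_seminorm k p f)%E by apply: ereal_sup_ubound; exists pi.
have piE : (\sum_(S \in pi) approx_error k f S `^ p)%E =
    (\sum_i approx_error k f (Q i) `^ p)%E.
  transitivity (\sum_(S <- [seq Q i | i <- enum I])
      approx_error k f S `^ p)%E; last by rewrite big_map big_enum.
  by rewrite -fsbig_seq// map_inj_uniq// enum_uniq.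
have le1 : ((\sum_i e i `^ p)%:E <= \sum_(S \in pi) approx_error k f S `^ p)%E.
  rewrite piE -sumEFin; apply: lee_sum => i _.
  rewrite -poweR_EFin; apply: gt0_ler_poweR.
  - exact: ltW.
  - by rewrite in_itv/= lee_fin e0 leey.
  - by rewrite in_itv/= leey approx_error_ge0.
  - by apply: error_lower_bound_approx; [exact: bu|exact: e0|exact: He].
have le2 : (((\sum_i e i `^ p) `^ p^-1)%:E <= V_seminorm k p f)%E.
  apply: le_trans piV; rewrite -poweR_EFin; apply: gt0_ler_poweR => //.
  - by rewrite invr_ge0 ltW.
  - by rewrite in_itv/= leey andbT lee_fin sumr_ge0// => i _; exact: powR_ge0.
  - rewrite in_itv/= leey andbT fsume_ge0// => S _; exact: poweR_ge0.
rewrite -[X in X <= _](@powRr1 _ (\sum_i e i `^ p)); last first.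
  by apply: sumr_ge0 => i _; exact: powR_ge0.
rewrite -[1](@mulVf _ p) ?gt_eqF// powRrM.
apply: ge0_ler_powR; rewrite ?nnegrE ?powR_ge0 ?fine_ge0//; first lra.
by rewrite -lee_fin fineK.
Qed.

Lemma V_space_bounded (R : realType) (d k : nat) (p : R)
    (f : cube_pt R d -> R) : V_space k p f ->
  exists M : R, forall x, unit_cube x -> `|zero_extension f x| <= M.
Proof.
move=> [/ex_strict_bound_gt0[M M0 fM] _]; exists M => x /unit_cubeP[y <-].
by rewrite zero_extensionE ltW//; exact: fM.
Qed.

(** * Limits and discontinuities *)

Definition limit_along (R : realType) (d : nat) (F : 'rV[R]_d -> R)
    (S : set 'rV[R]_d) (x : 'rV[R]_d) (l : R) : Prop :=
  forall e, 0 < e -> exists2 delta : R, 0 < delta & forall y, S y ->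
    (forall i, `|y ord0 i - x ord0 i| < delta) -> `|F y - l| < e.

Lemma cauchy_limit_along (R : realType) (d : nat) (F : 'rV[R]_d -> R)
    (S : set 'rV[R]_d) (x : 'rV[R]_d) :
  (forall e, 0 < e -> exists2 delta : R, 0 < delta & forall y z, S y -> S z ->
     (forall i, `|y ord0 i - x ord0 i| < delta) ->
     (forall i, `|z ord0 i - x ord0 i| < delta) -> `|F y - F z| < e) ->
  exists l, limit_along F S x l.
Proof.
move=> FS.
pose B (t : R) := S `&` [set y | forall i, `|y ord0 i - x ord0 i| < t].
have [[t t0 tB]|nB] := pselect (exists2 t : R, 0 < t & B t = set0).
  exists 0 => e e0; exists t => // y yS yt.
  by have : B t y by []; rewrite tB.
pose G := filter_from [set t : R | 0 < t] B.
have GF : ProperFilter G.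
  apply: filter_from_proper; last first.
    move=> t t0; apply/set0P/eqP => tB; apply: nB; by exists t.
  apply: filter_from_filter; first by exists 1; rewrite /=.
  move=> s t s0 t0; exists (Num.min s t); first by rewrite /= lt_min s0.
  by move=> y [yS yst]; split; split=> // i; have := yst i; rewrite lt_min => /andP[].
have FG : cvg (F @ G).
  apply: cauchy_cvg; apply: cauchy_exP => e e0.
  have [t t0 tF] := FS e e0.
  have [y [yS yt]] : exists y, B t y.
    by apply: contrapT => nex; apply: nB; exists t => //; apply/seteqP; split=> // y By; apply: nex; exists y.
  exists (F y); exists t => // z [zS zt]; exact: tF.
exists (lim (F @ G)) => e e0.
have /cvgrPdist_lt/(_ e e0)[t t0 tF] := FG.
by exists t => // y yS yt; rewrite distrC; apply: tF.
Qed.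

Definition half_space (R : realType) (d : nat) (x : 'rV[R]_d) (i : 'I_d)
    (s : R) : set 'rV[R]_d :=
  [set y | unit_cube y /\ 0 < s * (y ord0 i - x ord0 i)].

Lemma exists_near_neq (R : realType) (t delta : R) : 0 <= t <= 1 -> 0 < delta ->
  exists u, [/\ 0 <= u <= 1, u != t & `|u - t| < delta].
Proof.
move=> t01 delta0; pose m := Num.min (1 / 2) (delta / 2).
have m0 : 0 < m by rewrite lt_min; lra.
have m1 : m <= 1 / 2 by rewrite ge_min lexx.
have m2 : m <= delta / 2 by rewrite ge_min lexx orbT.
case: (lerP t (1 / 2)) => th; [exists (t + m)|exists (t - m)]; split.
- lra.
- by rewrite -subr_eq0 addrAC subrr add0r gt_eqF.
- by rewrite addrAC subrr add0r gtr0_norm//; lra.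
- lra.
- by rewrite -subr_eq0 addrAC subrr add0r oppr_eq0 gt_eqF.
- by rewrite addrAC subrr add0r normrN gtr0_norm//; lra.
Qed.

(** In dimension at least two, two of the half spaces at [x] with different
    normal coordinates intersect arbitrarily close to [x], so that all the
    half-space limits agree; and the half spaces cover the punctured cube. *)
Lemma punctured_limit (R : realType) (d k : nat) (p C M : R)
    (F : 'rV[R]_d -> R) (x : 'rV[R]_d) : (2 <= d)%N -> (0 < k)%N ->
  cube_variation_le k p C F -> (forall x, unit_cube x -> `|F x| <= M) ->
  unit_cube x ->
  exists l, limit_along F [set y | unit_cube y /\ y != x] x l.
Proof.
move=> d2 k0 FC FM xu; apply: cauchy_limit_along => e e0.
have e4 : 0 < e / 4 by lra.
pose sg (b : bool) : R := if b then 1 else -1.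
have sg1 b : sg b = 1 \/ sg b = -1 by case: b; [left|right].
have H (ib : 'I_d * bool) :=
  half_space_cauchy ib.1 k0 FC FM xu (sg1 ib.2) e4.
pose D ib : R := sval (cid2 (H ib)).
have D0 ib : 0 < D ib by rewrite /D; case: cid2.
have DP i b (y z : 'rV[R]_d) : half_space x i (sg b) y -> half_space x i (sg b) z ->
    (forall j, `|y ord0 j - x ord0 j| < D (i, b)) ->
    (forall j, `|z ord0 j - x ord0 j| < D (i, b)) -> `|F y - F z| < e / 4.
  move=> [yu ys] [zu zs]; rewrite /D; case: cid2 => /= t t0 tP yt zt.
  exact: (tP y z).
have [delta [delta0 _ deltaD]] := finite_pos_lbound D0.
pose near (y : 'rV[R]_d) := forall j : 'I_d, `|y ord0 j - x ord0 j| < delta.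
have side (y : 'rV[R]_d) i : y ord0 i != x ord0 i ->
    exists b, 0 < sg b * (y ord0 i - x ord0 i).
  rewrite neq_lt => /orP[|] yx; first by exists false; rewrite /sg; lra.
  by exists true; rewrite /sg; lra.
(* [w] lies in both half spaces *)
have two (y z : 'rV[R]_d) i j : unit_cube y -> unit_cube z -> near y -> near z -> i != j ->
    y ord0 i != x ord0 i -> z ord0 j != x ord0 j -> `|F y - F z| < e / 2.
  move=> yu zu yn zn ij /side[b yb] /side[c zc].
  pose w : 'rV[R]_d := \row_l
    (if l == i then y ord0 i else if l == j then z ord0 j else x ord0 l).
  have wi : w ord0 i = y ord0 i by rewrite mxE eqxx.
  have wj : w ord0 j = z ord0 j by rewrite mxE eq_sym (negPf ij) eqxx.
  have wu : unit_cube w by move=> l; rewrite mxE; case: ifP => // _; case: ifP.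
  have wn : near w.
    move=> l; rewrite mxE; case: eqP => [->//|_]; case: eqP => [->//|_].
    by rewrite subrr normr0.
  have nD (v : 'rV[R]_d) q : near v -> forall l, `|v ord0 l - x ord0 l| < D q.
    by move=> vn l; apply: lt_le_trans (vn l) (deltaD q).
  have yw : `|F y - F w| < e / 4.
    by apply: (DP i b); try exact: nD; split => //; rewrite ?wi.
  have wz : `|F w - F z| < e / 4.
    by apply: (DP j c); try exact: nD; split => //; rewrite ?wj.
  by have := ler_distD (F w) (F y) (F z); lra.
have neqP (y : 'rV[R]_d) : y != x -> exists i, y ord0 i != x ord0 i.
  move=> yx; apply/existsP; apply: contraNT yx; rewrite negb_exists => /forallP h.
  by apply/eqP/rowP => c; have := h c; rewrite negbK => /eqP.
exists delta => // y z [yu /neqP[i yi]] [zu /neqP[j zj]] yn zn.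
case: (eqVneq i j) => [ij|ij]; last by have := two y z i j yu zu yn zn ij yi zj; lra.
have [c ci] : exists c : 'I_d, c != i.
  pose o0 : 'I_d := Ordinal (ltnW d2); pose o1 : 'I_d := Ordinal d2.
  by case: (eqVneq i o0) => [->|]; [exists o1|exists o0; rewrite eq_sym].
(* when [y] and [z] are seen through the same coordinate, pass through a point
   [v] that is off [x] in another one *)
have [u [u01 ux un]] := exists_near_neq (xu c) delta0.
pose v : 'rV[R]_d := \row_l (if l == c then u else x ord0 l).
have vu : unit_cube v by move=> l; rewrite mxE; case: ifP.
have vn : near v.
  by move=> l; rewrite mxE; case: eqP => [->//|_]; rewrite subrr normr0.
have vc : v ord0 c != x ord0 c by rewrite mxE eqxx.
have ic : i != c by rewrite eq_sym.
have cj : c != j by rewrite -ij.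
have := two y v i c yu vu yn vn ic yi vc.
have := two v z c j vu zu vn zn cj vc zj.
by have := ler_distD (F v) (F y) (F z); lra.
Qed.

Lemma nbhs_cube_pt (R : realType) (d : nat) (x : cube_pt R d)
    (A : set (cube_pt R d)) (delta : R) : 0 < delta ->
  (forall y : cube_pt R d, (forall i,
     `|set_val y ord0 i - set_val x ord0 i| < delta) -> A y) -> nbhs x A.
Proof.
move=> delta0 dA.
have : nbhs (set_val x) [set z : 'rV[R]_d |
    forall i, `|z ord0 i - set_val x ord0 i| < delta].
  apply/nbhs_rowP; exists delta => // y yx i; rewrite distrC; exact: yx.
move=> /(@initial_continuous (cube_pt R d) 'rV[R]_d set_val x) H.
have {}H : nbhs x [set y : cube_pt R d |
    forall i, `|set_val y ord0 i - set_val x ord0 i| < delta] by exact: H.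
by apply: filterS H => y yx; exact: dA.
Qed.

Lemma limit_along_within (R : realType) (d : nat) (f : cube_pt R d -> R)
    (S : set 'rV[R]_d) (D : set (cube_pt R d)) (x : cube_pt R d) (l : R) :
  (forall y, D y -> S (set_val y)) ->
  limit_along (zero_extension f) S (set_val x) l ->
  f @ within D (nbhs x) --> l.
Proof.
move=> DS fl; apply/cvgrPdist_lt => e e0; have [delta delta0 H] := fl e e0.
rewrite near_withinE; apply: (nbhs_cube_pt delta0) => y yx Dy.
by rewrite distrC -zero_extensionE; apply: H => //; exact: DS.
Qed.

(** The discontinuities are the union over [n] of the sets of points where the
    oscillation is at least [1 / (n + 1)], which are finite. *)
Lemma countable_discontinuities (R : realType) (d k : nat) (p : R)
    (f : cube_pt R d -> R) : 1 <= p -> (0 < k)%N -> V_space k p f ->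
  countable (discontinuities f).
Proof.
move=> p1 k0 fV; have [C fC] := V_space_variation p1 fV.
have [M fM] := V_space_bounded fV.
pose A (n : nat) : set (cube_pt R d) := [set x : cube_pt R d | forall delta : R, 0 < delta ->
  exists y : cube_pt R d,
    (forall i, `|set_val y ord0 i - set_val x ord0 i| <= delta) /\
    n.+1%:R^-1 <= `|f y - f x|].
have Afin n : finite_set (A n).
  apply: contrapT => /infinite_set_fset Ainf.
  have e0 : 0 < n.+1%:R^-1 :> R by rewrite invr_gt0.
  have E0 : 0 < (n.+1%:R^-1 / 4 : R) `^ p by apply: powR_gt0; rewrite divr_gt0.
  have [B BA cB] :=
    Ainf (Num.Def.trunc (`|C| / (n.+1%:R^-1 / 4) `^ p)).+1.
  pose t := in_tuple (finmap.enum_fset B).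
  pose x b : 'rV[R]_d := set_val (tnth t b).
  have tI : injective (tnth t) by apply/tuple_uniqP; exact: finmap.fset_uniq.
  have xI : injective x by move=> b c /set_val_inj /tI.
  have xu b : unit_cube (x b) by exact: unit_cube_val.
  have := ltNge C (#|'I_(size (finmap.enum_fset B))|%:R * (n.+1%:R^-1 / 4) `^ p).
  rewrite (oscillation_points_bound k0 fC fM e0 xI xu)/=; last first.
    move=> b delta delta0; have [y [yx yf]] := BA (tnth t b) (mem_tnth b t) delta delta0.
    exists (set_val y); split; [exact: unit_cube_val|exact: yx|].
    by rewrite !zero_extensionE.
  move/negP; apply.
  rewrite -ltr_pdivrMr//; apply: le_lt_trans (_ : `|C| / (n.+1%:R^-1 / 4) `^ p < _).
    by rewrite ler_pM2r ?invr_gt0// ler_norm.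
  apply: lt_le_trans (truncnS_gt _) _.
  by rewrite ler_nat card_ord.
apply: (@sub_countable _ _ _ (\bigcup_n A n)); last first.
  by apply: bigcup_countable => // n _; exact: finite_set_countable.
apply: subset_card_le => x xd; apply: contrapT => xA; apply: xd.
apply/(@cvgrPdist_lt _ _ _ _ (nbhs_filter x)) => e e0.
have [n ne] : exists n : nat, n.+1%:R^-1 < e.
  exists (Num.Def.trunc e^-1); rewrite invf_plt ?posrE//; exact: truncnS_gt.
have [delta delta0 H] : exists2 delta : R, 0 < delta & forall y : cube_pt R d,
    (forall i, `|set_val y ord0 i - set_val x ord0 i| <= delta) ->
    `|f y - f x| < n.+1%:R^-1.
  apply: contrapT => nd; apply: xA; exists n => // delta delta0.
  apply: contrapT => ny; apply: nd; exists delta => // y yx.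
  by rewrite ltNge; apply/negP => yf; apply: ny; exists y.
apply: (nbhs_cube_pt delta0) => y yx; rewrite distrC.
by apply: lt_trans ne; apply: H => i; apply: ltW.
Qed.

(** * Finite differences *)

Definition incr (R : realType) (d : nat) (h : R) (i : 'I_d) (x : 'rV[R]_d) :
  'rV[R]_d := x + h *: delta_mx ord0 i.

Lemma incrE (R : realType) (d : nat) (h : R) (i c : 'I_d) (x : 'rV[R]_d) :
  incr h i x ord0 c = x ord0 c + h *+ (i == c).
Proof. by rewrite !mxE eqxx /= eq_sym mulr_natr. Qed.

Fixpoint fdiff (R : realType) (d : nat) (h : R) (s : seq 'I_d)
    (F : 'rV[R]_d -> R) : 'rV[R]_d -> R :=
  if s is i :: s' then fdiff h s' (fun x => F (incr h i x) - F x) else F.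

Section FiniteDifferences.
Variables (R : realType) (d : nat).
Implicit Types (h : R) (F G : 'rV[R]_d -> R) (s : seq 'I_d) (x v : 'rV[R]_d).

Lemma eq_fdiff h s F G : F =1 G -> fdiff h s F =1 fdiff h s G.
Proof.
by elim: s F G => [|i s IH] F G FG //= x; apply: IH => y; rewrite !FG.
Qed.

Lemma fdiff_shift h s F v x :
  fdiff h s (fun y => F (y + v)) x = fdiff h s F (x + v).
Proof.
elim: s F x => [|i s IH] F x //=; rewrite -IH; apply: eq_fdiff => y.
by rewrite /incr addrAC.
Qed.

Lemma fdiff0 h s x : fdiff h s (fun=> 0) x = 0.
Proof.
elim: s x => [|i s IH] x //=; rewrite -[RHS](IH x); apply: eq_fdiff => y.
by rewrite subrr.
Qed.

Lemma fdiffD h s F G x :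
  fdiff h s (fun y => F y + G y) x = fdiff h s F x + fdiff h s G x.
Proof.
elim: s F G x => [|i s IH] F G x //=; rewrite -IH; apply: eq_fdiff => y; ring.
Qed.

Lemma fdiffB h s F G x :
  fdiff h s (fun y => F y - G y) x = fdiff h s F x - fdiff h s G x.
Proof.
elim: s F G x => [|i s IH] F G x //=; rewrite -IH; apply: eq_fdiff => y; ring.
Qed.

Lemma fdiff_sum h s (I : Type) (r : seq I) (F : I -> 'rV[R]_d -> R) x :
  fdiff h s (fun y => \sum_(l <- r) F l y) x = \sum_(l <- r) fdiff h s (F l) x.
Proof.
elim: r => [|l r IH].
  by rewrite big_nil -[RHS](fdiff0 h s x); apply: eq_fdiff => y; rewrite big_nil.
rewrite big_cons -IH -fdiffD; apply: eq_fdiff => y; rewrite big_cons //.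
Qed.

Lemma fdiff_cons h i s F x :
  fdiff h (i :: s) F x = fdiff h s F (incr h i x) - fdiff h s F x.
Proof. by rewrite /= fdiffB /incr fdiff_shift. Qed.

Lemma fdiff_bound h s F (B : R) x : 0 <= h ->
  (forall y : 'rV[R]_d, (forall c, x ord0 c <= y ord0 c <= x ord0 c + h * (size s)%:R) ->
     `|F y| <= B) ->
  `|fdiff h s F x| <= 2 ^+ size s * B.
Proof.
move=> h0; elim: s x => [|i s IH] x FB.
  by rewrite mul1r; apply: FB => c; rewrite mulr0 addr0 lexx.
rewrite fdiff_cons (le_trans (ler_normB _ _))// exprS -mulrA mulr_natl mulr2n.
apply: lerD; apply: IH => y yx; apply: FB => c; have := yx c.
  rewrite incrE /= -natr1; case: (i == c); rewrite ?mulr1n ?mulr0n; lra.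
by rewrite /= -natr1; lra.
Qed.

Lemma fdiff_continuous h s F :
  (forall x, limit_along F setT x (F x)) ->
  forall x, limit_along (fdiff h s F) setT x (fdiff h s F x).
Proof.
move=> FC; elim: s F FC => [|i s IH] F FC //=; apply: IH => x e e0.
have e2 : 0 < e / 2 by lra.
have [t t0 tF] := FC x _ e2.
have [u u0 uF] := FC (incr h i x) _ e2.
exists (Num.min t u) => [|y _ yx]; first by rewrite lt_min t0.
have F1 : `|F y - F x| < e / 2.
  by apply: tF => // c; have := yx c; rewrite lt_min => /andP[].
have F2 : `|F (incr h i y) - F (incr h i x)| < e / 2.
  apply: uF => // c; have := yx c; rewrite lt_min => /andP[_].
  by rewrite !incrE opprD addrACA subrr addr0.
have := ler_normB (F (incr h i y) - F (incr h i x)) (F y - F x).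
have -> : F (incr h i y) - F (incr h i x) - (F y - F x) =
  F (incr h i y) - F y - (F (incr h i x) - F x) by ring.
lra.
Qed.

(** A difference with step [L * h] is the sum of [L ^ size s] differences with
    step [h]. Summing over translates before bounding these terms is what lets
    the packing bound be used for each term. *)
Lemma fdiff_refine (T : finType) (theta : T -> 'rV[R]_d) h (L : nat) (Z : R)
    s F x : 0 <= h ->
  (forall w : 'rV[R]_d, (forall c, x ord0 c <= w ord0 c <=
      x ord0 c + L%:R * h * (count_mem c s)%:R) ->
     \sum_t `|fdiff h s F (w + theta t)| <= Z) ->
  \sum_t `|fdiff (L%:R * h) s F (x + theta t)| <= L%:R ^+ size s * Z.
Proof.
move=> h0; elim: s F x => [|i s IH] F x HZ.
  by rewrite mul1r; apply: HZ => c; rewrite mulr0 addr0 lexx.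
pose F' y := F (incr h i y) - F y.
have tele y : F (incr (L%:R * h) i y) - F y =
    \sum_(0 <= l < L) F' (y + (l%:R * h) *: delta_mx ord0 i).
  rewrite (telescope_sumr_eq (fun l : nat => F (y + (l%:R * h) *: delta_mx ord0 i))).
  - by rewrite mul0r scale0r addr0.
  - by [].
  by move=> l _; rewrite /F' /incr -addrA -scalerDl -natr1 mulrDl mul1r.
have E y : fdiff (L%:R * h) (i :: s) F y = \sum_(0 <= l < L)
    fdiff (L%:R * h) s F' (y + (l%:R * h) *: delta_mx ord0 i).
  rewrite /= (eq_fdiff _ _ tele) fdiff_sum; apply: eq_bigr => l _.
  by rewrite fdiff_shift.
apply: (@le_trans _ _ (\sum_(0 <= l < L) \sum_t `|fdiff (L%:R * h) s F'
    ((x + (l%:R * h) *: delta_mx ord0 i) + theta t)|)).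
  rewrite exchange_big; apply: ler_sum => t _; rewrite E.
  rewrite (le_trans (ler_norm_sum _ _ _))//; apply: ler_sum => l _.
  by rewrite addrAC.
have -> : L%:R ^+ size (i :: s) * Z = \sum_(0 <= l < L) L%:R ^+ size s * Z.
  by rewrite sumr_const_nat subn0 -[RHS]mulr_natl mulrA -exprS.
rewrite big_nat [X in _ <= X]big_nat; apply: ler_sum => l lL.
apply: IH => w wx; apply: HZ => c.
have := wx c; rewrite -/(incr _ _ _) incrE /= natrD.
have lh : l%:R * h <= L%:R * h by rewrite ler_wpM2r// ler_nat; case/andP: lL => _ /ltnW.
have l0 : 0 <= l%:R * h by rewrite mulr_ge0.
case: (i == c); rewrite ?mulr1n ?mulr0n; nra.
Qed.

End FiniteDifferences.

(** * Differences of polynomials and functions on a lattice *)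

Definition vanishing_fdiff (R : realType) (d : nat) (h : R) (n : nat)
    (F : 'rV[R]_d -> R) : Prop :=
  forall s, size s = n -> forall x, fdiff h s F x = 0.

Section PolynomialDifferences.
Variables (R : realType) (d : nat) (h : R).
Implicit Types (F G : 'rV[R]_d -> R) (x v : 'rV[R]_d).

Lemma vanishing_fdiffS n F :
  (forall i, vanishing_fdiff h n (fun x => F (incr h i x) - F x)) ->
  vanishing_fdiff h n.+1 F.
Proof. by move=> H [|i s] //= [sn]; exact: H. Qed.

Lemma eq_vanishing_fdiff n F G : vanishing_fdiff h n F -> F =1 G ->
  vanishing_fdiff h n G.
Proof. by move=> H FG s sn x; rewrite -(eq_fdiff h s FG) H. Qed.

Lemma vanishing_fdiff_cst0 n : vanishing_fdiff h n (fun _ : 'rV[R]_d => 0).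
Proof. by move=> s _ x; rewrite fdiff0. Qed.

Lemma vanishing_fdiffD n F G : vanishing_fdiff h n F -> vanishing_fdiff h n G ->
  vanishing_fdiff h n (fun x => F x + G x).
Proof. by move=> HF HG s sn x; rewrite fdiffD HF// HG// addr0. Qed.

Lemma vanishing_fdiff_shift n F v : vanishing_fdiff h n F ->
  vanishing_fdiff h n (fun x => F (x + v)).
Proof. by move=> HF s sn x; rewrite fdiff_shift HF. Qed.

Lemma leq_vanishing_fdiff n n' F : (n <= n')%N ->
  vanishing_fdiff h n F -> vanishing_fdiff h n' F.
Proof.
move=> /subnKC <-; elim: (n' - n)%N => [|k IH] HF; first by rewrite addn0.
rewrite addnS => -[|i s]// [sn] x.
by rewrite fdiff_cons !(IH HF _ sn) subrr.
Qed.

Lemma vanishing_fdiff_cst (c : R) : vanishing_fdiff h 1 (fun _ : 'rV[R]_d => c).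
Proof.
apply: vanishing_fdiffS => i; apply: (eq_vanishing_fdiff (@vanishing_fdiff_cst0 _)).
by move=> x; rewrite subrr.
Qed.

Lemma vanishing_fdiff_coord i : vanishing_fdiff h 2 (fun x : 'rV[R]_d => x ord0 i).
Proof.
apply: vanishing_fdiffS => j.
apply: (eq_vanishing_fdiff (@vanishing_fdiff_cst (h *+ (j == i)))).
by move=> x; rewrite incrE; ring.
Qed.

(** Leibniz rule; it reduces monomials to coordinates, whose second differences
    vanish. *)
Lemma vanishing_fdiffM m n F G :
  vanishing_fdiff h m.+1 F -> vanishing_fdiff h n.+1 G ->
  vanishing_fdiff h (m + n).+1 (fun x => F x * G x).
Proof.
have [N] := ubnP (m + n); elim: N m n F G => [//|N IH] m n F G mnN HF HG.
apply: vanishing_fdiffS => i.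
pose dF x := F (incr h i x) - F x; pose dG x := G (incr h i x) - G x.
have dF0 : vanishing_fdiff h m dF.
  by move=> s sm x; have := HF (i :: s); rewrite /= sm; exact.
have dG0 : vanishing_fdiff h n dG.
  by move=> s sm x; have := HG (i :: s); rewrite /= sm; exact.
have G0 : vanishing_fdiff h n.+1 (fun x => G (incr h i x)).
  exact: vanishing_fdiff_shift.
apply: (@eq_vanishing_fdiff _ (fun x => dF x * G (incr h i x) + F x * dG x)); last first.
  by move=> x; rewrite /dF /dG; ring.
apply: vanishing_fdiffD.
  case: m dF0 mnN {HF} => [dF0 _|m dF0 mnN]; last exact: IH.
  apply: (eq_vanishing_fdiff (@vanishing_fdiff_cst0 _)) => x.
  by have /= -> := dF0 [::] erefl x; rewrite mul0r.
case: n dG0 mnN {HG G0} => [dG0 _|n dG0 mnN].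
  apply: (eq_vanishing_fdiff (@vanishing_fdiff_cst0 _)) => x.
  by have /= -> := dG0 [::] erefl x; rewrite mulr0.
by rewrite addnS; apply: IH => //; rewrite -addnS.
Qed.

Lemma vanishing_fdiffX i n : vanishing_fdiff h n.+1 (fun x : 'rV[R]_d => x ord0 i ^+ n).
Proof.
elim: n => [|n IH]; first exact: vanishing_fdiff_cst.
apply: (eq_vanishing_fdiff (vanishing_fdiffM (@vanishing_fdiff_coord i) IH)) => x.
by rewrite exprS.
Qed.

Lemma vanishing_fdiff_peval k (m : mpoly.mpoly d R) : poly_space k m ->
  vanishing_fdiff h k (peval m).
Proof.
move=> mk; apply: leq_vanishing_fdiff (mk : (_ <= k)%N) _.
move=> s sm x; pose T c (y : 'rV[R]_d) := mpoly.mcoeff c m *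
  \prod_i y ord0 i ^+ mpoly.fun_of_multinom c i.
have E y : peval m y = \sum_(c <- mpoly.msupp m) T c y.
  by rewrite /peval mpoly.mevalE.
rewrite (eq_fdiff _ _ E) fdiff_sum big_seq big1 // => c cm.
suff H (r : seq 'I_d) :
    vanishing_fdiff h (\sum_(i <- r) mpoly.fun_of_multinom c i).+1
      (fun y : 'rV[R]_d => \prod_(i <- r) y ord0 i ^+ mpoly.fun_of_multinom c i).
  have {}H := vanishing_fdiffM (@vanishing_fdiff_cst (mpoly.mcoeff c m)) (H _).
  have le : ((0 + \sum_(i < d) mpoly.fun_of_multinom c i).+1 <=
      mpoly.msize m)%N.
    by rewrite add0n -mpoly.mdegE; exact: mpoly.msize_mdeg_lt.
  exact: (leq_vanishing_fdiff le (H (index_enum 'I_d)) sm).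
elim: r => [|i r IH].
  rewrite big_nil; apply: (eq_vanishing_fdiff (@vanishing_fdiff_cst 1)) => y.
  by rewrite big_nil.
rewrite big_cons; apply: (eq_vanishing_fdiff (vanishing_fdiffM (@vanishing_fdiffX i _) IH)).
by move=> y; rewrite big_cons.
Qed.

End PolynomialDifferences.

Definition lattice_pt (R : realType) (d : nat) (h : R) (g : 'I_d -> nat) :
  'rV[R]_d := \row_c (h * (g c)%:R).

Section Lattice.
Variables (R : realType) (d : nat) (h : R).
Implicit Types (F : 'rV[R]_d -> R) (g : 'I_d -> nat) (s : seq 'I_d).

Let up (i : 'I_d) g : 'I_d -> nat := fun c => (g c + (i == c))%N.

Lemma incr_lattice_pt i g : incr h i (lattice_pt h g) = lattice_pt h (up i g).
Proof.
apply/rowP => c; rewrite incrE !mxE /up natrD mulrDr; congr (_ + _).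
by rewrite mulr_natr.
Qed.

Lemma sum_up i g : (\sum_c up i g c = (\sum_c g c).+1)%N.
Proof.
rewrite /up big_split /= -addn1; congr (_ + _)%N.
rewrite (bigD1 i)//= eqxx big1 ?addn0// => c /negPf ci.
by rewrite eq_sym ci.
Qed.

Lemma fdiff_lattice_eq0 F s g (n : nat) :
  (forall g', (\sum_c g' c <= n)%N -> F (lattice_pt h g') = 0) ->
  (\sum_c g c + size s <= n)%N -> fdiff h s F (lattice_pt h g) = 0.
Proof.
move=> F0; elim: s g => [|i s IH] g gs.
  by apply: F0; move: gs; rewrite addn0.
move: gs; rewrite [size _]/= => gs.
by rewrite fdiff_cons incr_lattice_pt !IH ?subrr ?sum_up//; lia.
Qed.

(** A function on a lattice whose [k]-th differences vanish is determined by its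
    values on the simplex of points of weight less than [k]: its differences
    of order [j] are constant along the lattice as soon as those of order [j + 1]
    vanish, and by assumption they are zero at the origin when [j < k]. *)
Lemma lattice_eq0 k N F :
  (forall s g, size s = k -> (forall c, g c + count_mem c s < N)%N ->
     fdiff h s F (lattice_pt h g) = 0) ->
  (forall g, (\sum_c g c < k)%N -> F (lattice_pt h g) = 0) ->
  forall g, (forall c, g c < N)%N -> F (lattice_pt h g) = 0.
Proof.
move=> Fk F0 g gN.
suff H j : (j <= k)%N -> forall s g', size s = (k - j)%N ->
    (forall c, g' c + count_mem c s < N)%N -> fdiff h s F (lattice_pt h g') = 0.
  apply: (H k (leqnn k) [::]); first by rewrite subnn.
  by move=> c; rewrite addn0.
elim: j {g gN} => [_|j IH jk] s; first by rewrite subn0; exact: Fk.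
move=> g sk; have [n] := ubnP (\sum_c g c); elim: n g => [//|n IHn] g gn gs.
have [g0|ng] := pselect (forall c, g c = 0%N).
  apply: (fdiff_lattice_eq0 (n := k.-1)) => [g' g'k|].
    by apply: F0; move: jk; lia.
  by rewrite big1 ?sk => [|c _]; [lia|exact: g0].
have [i gi] : exists i, (0 < g i)%N.
  apply: contrapT => H; apply: ng => c; apply/eqP; rewrite -leqn0 leqNgt.
  by apply/negP => c0; apply: H; exists c.
pose g0 c := (g c - (i == c))%N.
have ug : up i g0 = g.
  by apply/funext => c; rewrite /up /g0 subnK//; case: eqP => // <-.
have := IH (ltnW jk) (i :: s) g0.
rewrite fdiff_cons incr_lattice_pt ug (IHn g0) ?subr0.
- apply; first by rewrite /= sk; lia.
  move=> c; have := gs c; rewrite /= -[in X in (X < N)%N -> _]ug /up; lia.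
- by rewrite -ltnS -(sum_up i) ug.
- by move=> c; have := gs c; rewrite -[in X in (X < N)%N -> _]ug /up; lia.
Qed.

End Lattice.

(** * Newton interpolation on a lattice *)

Section Interpolation.
Variables (R : realType) (d : nat) (h : R).
Hypothesis h_neq0 : h != 0.

Let linear_factor (i : 'I_d) (l : nat) : mpoly.mpoly d R :=
  mpoly.mpolyX R (mpoly.mnm1 i) - mpoly.mpolyC d (h * l%:R).

Definition newton_poly (b : 'I_d -> nat) : mpoly.mpoly d R :=
  \prod_(i < d) \prod_(l < b i) linear_factor i l.

Lemma peval_newton_poly b g : peval (newton_poly b) (lattice_pt h g) =
  \prod_(i < d) \prod_(l < b i) (h * ((g i)%:R - l%:R)).
Proof.
rewrite /peval /newton_poly rmorph_prod; apply: eq_bigr => i _.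
rewrite rmorph_prod; apply: eq_bigr => l _.
by rewrite /= /linear_factor mpoly.mevalB mpoly.mevalXU mpoly.mevalC mxE mulrBr.
Qed.

Lemma newton_poly_diag b : peval (newton_poly b) (lattice_pt h b) != 0.
Proof.
rewrite peval_newton_poly; apply/prodf_neq0 => i _; apply/prodf_neq0 => l _.
by rewrite mulf_neq0// subr_eq0 eqr_nat neq_ltn ltn_ord orbT.
Qed.

Lemma newton_poly_eq0 b g i : (g i < b i)%N ->
  peval (newton_poly b) (lattice_pt h g) = 0.
Proof.
move=> gb; rewrite peval_newton_poly (bigD1 i)//= (bigD1 (Ordinal gb))//=.
by rewrite subrr mulr0 !mul0r.
Qed.

Lemma msize_newton_poly b : (mpoly.msize (newton_poly b) <= (\sum_i b i).+1)%N.
Proof.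
have lin i l : (mpoly.msize (linear_factor i l) <= 2)%N.
  rewrite /linear_factor (leq_trans (mpoly.msizeD_le _ _))// geq_max.
  rewrite mpoly.msizeX mpoly.mdeg1 /= mpoly.msizeN mpoly.msizeC.
  by case: (_ != _).
have prod_le (I : Type) (r : seq I) (P : I -> mpoly.mpoly d R) (n : I -> nat) :
    (forall i, mpoly.msize (P i) <= (n i).+1)%N ->
    (mpoly.msize (\prod_(i <- r) P i) <= (\sum_(i <- r) n i).+1)%N.
  move=> Pn; elim/big_rec2: _ => [|i q m _ IH]; first by rewrite mpoly.msize1.
  have [->|Pi0] := eqVneq (P i) 0; first by rewrite mul0r mpoly.msize0.
  have [->|m0] := eqVneq m 0; first by rewrite mulr0 mpoly.msize0.
  rewrite mpoly.msizeM//.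
  by move: (mpoly.msize _) (mpoly.msize _) (Pn i) IH => e f; lia.
apply: (prod_le) => i; rewrite -[X in (_ <= X.+1)%N]card_ord -sum1_card.
by apply: prod_le => l; exact: lin.
Qed.

(** The Newton polynomials of weight [n] vanish at the lattice points of weight
    at most [n] other than their own index, so that they correct the values on
    the layer of weight [n] without disturbing the previous layers. *)
Lemma newton_interpolation (k : nat) (u : ('I_d -> nat) -> R) :
  exists2 m, @poly_space R d k m &
    forall g, (\sum_c g c < k)%N -> peval m (lattice_pt h g) = u g.
Proof.
elim: k => [|n [m mn mu]].
  by exists 0 => //; rewrite /poly_space /= mpoly.msize0.
pose I := {ffun 'I_d -> 'I_n.+1}.
pose nat_of (b : I) : 'I_d -> nat := fun c => b c.
pose coef b := (u b - peval m (lattice_pt h b)) /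
  peval (newton_poly b) (lattice_pt h b).
exists (m + \sum_(b : I | (\sum_c nat_of b c == n)%N)
    coef (nat_of b) *: newton_poly (nat_of b)).
  rewrite /poly_space /= (leq_trans (mpoly.msizeD_le _ _))// geq_max.
  rewrite (leq_trans mn)//= (leq_trans (mpoly.msize_sum _ _ _))//.
  apply/bigmax_leqP => b /eqP bn.
  rewrite (leq_trans (mpoly.msizeZ_le _ _))// (leq_trans (msize_newton_poly _))//.
  by rewrite bn.
move=> g gn; have E : peval (m + \sum_(b : I | (\sum_c nat_of b c == n)%N)
    coef (nat_of b) *: newton_poly (nat_of b)) (lattice_pt h g) =
    peval m (lattice_pt h g) + \sum_(b : I | (\sum_c nat_of b c == n)%N)
    coef (nat_of b) * peval (newton_poly (nat_of b)) (lattice_pt h g).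
  rewrite /peval mpoly.mevalD raddf_sum; congr (_ + _).
  by apply: eq_bigr => b _; rewrite /= mpoly.mevalZ.
(* a multi-index of weight n dominated by g is g itself *)
have zero b : (\sum_c b c = n)%N -> b <> g ->
    peval (newton_poly b) (lattice_pt h g) = 0.
  move=> bn bg; have [[i gi]|ng] := pselect (exists i, (g i < b i)%N).
    exact: newton_poly_eq0 gi.
  have le i : (b i <= g i)%N by rewrite leqNgt; apply/negP => gi; apply: ng; exists i.
  case: bg; apply/funext => i; apply/eqP; rewrite eqn_leq le leqNgt.
  apply/negP => lt; suff : (\sum_c b c < \sum_c g c)%N by lia.
  rewrite (bigD1 i)//= [X in (_ < X)%N](bigD1 i)//= -addSn leq_add//.
  exact: leq_sum.
rewrite {}E; case: (ltnP (\sum_c g c) n) => gn'.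
  rewrite mu// big1 ?addr0// => b /eqP bn; rewrite zero ?mulr0// => bg.
  by move: gn'; rewrite -bg bn ltnn.
have {gn'}gn : (\sum_c g c = n)%N by lia.
have gb c : (g c < n.+1)%N by rewrite -gn ltnS (bigD1 c)//= leq_addr.
pose b : I := [ffun c => Ordinal (gb c)].
have bE : nat_of b = g by apply/funext => c; rewrite /nat_of ffunE.
rewrite (bigD1 b)/= ?bE ?gn// big1 ?addr0 => [|b' /andP[/eqP b'n b'b]].
  by rewrite divfK ?newton_poly_diag// addrC subrK.
rewrite zero ?mulr0// => b'g; case/eqP: b'b; apply/ffunP => c; apply: val_inj.
by rewrite [LHS](congr1 (fun f => f c) b'g) -bE.
Qed.

(** The zeros on the simplex propagate to the whole lattice, hence to infinitely
    many points of each ray through the origin and a lattice point. *)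
Lemma peval_lattice_eq0 (k : nat) (m : mpoly.mpoly d R) : poly_space k m ->
  (forall g, (\sum_c g c < k)%N -> peval m (lattice_pt h g) = 0) ->
  forall g (t : R), peval m (t *: lattice_pt h g) = 0.
Proof.
move=> mk m0 g t.
have lat g' : peval m (lattice_pt h g') = 0.
  have mV s g'' : size s = k ->
      (forall c, (g'' c + count_mem c s < (\sum_c g' c).+1)%N) ->
      fdiff h s (peval m) (lattice_pt h g'') = 0.
    by move=> sk _; exact: (vanishing_fdiff_peval h mk sk).
  apply: (lattice_eq0 mV m0) => c.
  by  rewrite ltnS (bigD1 c)//= leq_addr.
have [q _ qE] := peval_line m 0 (lattice_pt h g).
suff q0 : q = 0 by rewrite -[t *: _]add0r -qE q0 horner0.
apply/eqP; apply: contraT => qn0.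
have := @max_poly_roots R q [seq n%:R | n <- iota 0 (size q)] qn0.
rewrite size_map size_iota ltnn => H; apply: H.
  apply/allP => _ /mapP[n _ ->]; rewrite /root qE add0r.
  have -> : n%:R *: lattice_pt h g = lattice_pt h (fun c => n * g c)%N.
    by apply/rowP => c; rewrite !mxE natrM mulrCA.
  by rewrite lat.
rewrite map_inj_uniq ?iota_uniq// => a b /eqP.
by rewrite eqr_nat => /eqP.
Qed.

End Interpolation.

(** * Continuous functions of bounded variation are polynomials *)

(** With the threshold [lam] chosen at the end, this linearisation of the power
    does what Hoelder's inequality would do. *)
Lemma le_threshold_powR (R : realType) (p lam e : R) : 1 <= p -> 0 < lam ->
  0 <= e -> e <= lam * (1 + e `^ p * lam^-1 `^ p).
Proof.
move=> p1 lam0 e0; rewrite -powRM ?invr_ge0 ?(ltW lam0)//.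
rewrite -ler_pdivrMl// [_^-1 * _]mulrC.
have [le|/ltW ge] := leP (e / lam) 1.
  by rewrite (le_trans le)// lerDl powR_ge0.
by rewrite (le_trans (le1r_powR ge p1))// lerDr.
Qed.

Lemma exists_powR_lt_exp (R : realType) (d k : nat) (p K : R) :
  k%:R * p < d%:R -> exists2 n : nat, (0 < n)%N &
    K * (n%:R ^+ k) `^ p < n%:R ^+ d.
Proof.
move=> kpd; pose r := d%:R - k%:R * p; have r0 : 0 < r by rewrite subr_gt0.
pose n := (Num.Def.trunc (`|K| `^ r^-1)).+1; exists n => //.
have n0 : 0 < n%:R :> R by rewrite ltr0n.
rewrite -!powR_mulrn ?(ltW n0)// -powRrM.
have -> : d%:R = r + k%:R * p by rewrite /r subrK.
rewrite powRD; last by rewrite (gt_eqF n0) implybT.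
rewrite ltr_pM2r ?powR_gt0//.
apply: le_lt_trans (ler_norm K) _.
have -> : `|K| = (`|K| `^ r^-1) `^ r by rewrite -powRrM mulVf ?gt_eqF// powRr1.
by apply: gt0_ltr_powR; rewrite ?nnegrE ?powR_ge0 ?(ltW n0)//; exact: truncnS_gt.
Qed.

(** On each box of a family [w + k h theta + [0, k h]^d], the difference of
    order [k] is at most [2 ^ k] times the approximation error of the box, since
    the differences of polynomials vanish. *)
Lemma sum_fdiff_le (R : realType) (d k : nat) (p C lam h : R) (n : nat)
    (G : 'rV[R]_d -> R) (w : 'rV[R]_d) (s : seq 'I_d) :
  (0 < k)%N -> 1 <= p -> 0 < lam -> 0 < h -> size s = k ->
  cube_variation_le k p C G ->
  (forall c, 0 <= w ord0 c /\ w ord0 c + k%:R * h * n%:R <= 1) ->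
  \sum_(theta : {ffun 'I_d -> 'I_n})
    `|fdiff h s G (w + lattice_pt (k%:R * h) (fun c => theta c))| <=
  2 ^+ k * (lam * ((n ^ d)%:R + C * lam^-1 `^ p)).
Proof.
move=> k0 p1 lam0 h0 sk GC wu.
have kh0 : 0 < k%:R * h by rewrite mulr_gt0// ltr0n.
pose a (t : {ffun 'I_d -> 'I_n}) := w + lattice_pt (k%:R * h) (fun c => t c).
have aE t c : a t ord0 c = w ord0 c + k%:R * h * (t c)%:R by rewrite !mxE.
pose e t := `|fdiff h s G (a t)| / 2 ^+ k.
have two0 : 0 < 2 ^+ k :> R by rewrite exprn_gt0.
have eC : \sum_t e t `^ p <= C.
  apply: (GC _ a (fun=> k%:R * h) e) => //.
  - move=> t y yb c; have := yb c; rewrite aE; have [w0 w1] := wu c.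
    have tn : (t c)%:R + 1 <= n%:R :> R by rewrite natr1 ler_nat.
    have t0 : 0 <= (t c)%:R :> R by [].
    nra.
  - move=> t t' tt'; have [c tc] : exists c, t c != t' c.
      apply/existsP; apply: contraNT tt'; rewrite negb_exists => /forallP H.
      by apply/eqP/ffunP => c; apply/eqP; have := H c; rewrite negbK.
    exists c; rewrite !aE.
    have le (i j : 'I_n) : (i < j)%N ->
        k%:R * h * i%:R + k%:R * h <= k%:R * h * j%:R.
      move=> ij; rewrite -[X in _ + X]mulr1 -mulrDr ler_pM2l//.
      by rewrite natr1 ler_nat.
    move: tc; rewrite neq_ltn => /orP[] /le; [left|right]; lra.
  - by move=> t; rewrite divr_ge0// ltW.
  move=> t m mk B mB; rewrite ler_pdivrMr// mulrC.
  have -> : fdiff h s G (a t) = fdiff h s (fun y => G y - peval m y) (a t).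
    by rewrite fdiffB (vanishing_fdiff_peval h mk sk) subr0.
  rewrite -sk; apply: fdiff_bound; first exact: ltW.
  by move=> y ya; apply: mB => c; rewrite mulrC -sk.
rewrite (eq_bigr (fun t => 2 ^+ k * e t)); last first.
  by move=> t _; rewrite /e [RHS]mulrC divfK ?gt_eqF.
rewrite -mulr_sumr ler_pM2l//.
apply: (@le_trans _ _ (\sum_t lam * (1 + e t `^ p * lam^-1 `^ p))).
  apply: ler_sum => t _; apply: le_threshold_powR => //.
  by rewrite divr_ge0// ltW.
rewrite -mulr_sumr ler_pM2l// big_split /= sumr_const card_ffun !card_ord.
by rewrite lerD2l -mulr_suml ler_wpM2r// powR_ge0.
Qed.

(** Refining the mesh [n] times multiplies the number of small differences by
    [n ^ k], while the packing bound makes their average of order [n ^ (- d / p)];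
    as [k < d / p], the average over small translates of the difference with
    the fixed step [H] is zero, and so is its value by continuity. *)
Lemma fdiff_eq0_of_variation (R : realType) (d k : nat) (p C H : R)
    (G : 'rV[R]_d -> R) (x : 'rV[R]_d) (s : seq 'I_d) :
  (0 < k)%N -> 1 <= p -> k%:R * p < d%:R -> cube_variation_le k p C G ->
  (forall y, limit_along G setT y (G y)) ->
  0 < H -> size s = k ->
  (forall c, 0 <= x ord0 c /\ x ord0 c + H * (count_mem c s)%:R + H <= 1) ->
  fdiff H s G x = 0.
Proof.
move=> k0 p1 kpd GC Gc H0 sk xu; apply/eqP; apply: contraT => nz.
pose eta := `|fdiff H s G x| / 2.
have eta0 : 0 < eta by rewrite divr_gt0// normr_gt0.
have [rho rho0 rhoP] := fdiff_continuous H s Gc x eta0.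
have k0R : 0 < k%:R :> R by rewrite ltr0n.
(* translates by less than [H / r] keep the difference above [eta] *)
pose r := (Num.Def.trunc (H / rho)).+1.
have r0 : 0 < r%:R :> R by rewrite ltr0n.
have Hr : H / r%:R < rho.
  by rewrite ltr_pdivrMr// mulrC -ltr_pdivrMr//; exact: truncnS_gt.
have r1 : 1 <= r%:R :> R by rewrite ler1n.
(* with [L = k * r * n], the factors [L ^ k] from the refinement and [2 ^ k] from
   [sum_fdiff_le] multiply to [A * n ^ k] *)
pose A : R := (2 * (k * r)%:R) ^+ k.
have A0 : 0 < A by rewrite exprn_gt0// mulr_gt0// ltr0n muln_gt0 k0.
have [n n0 nK] := exists_powR_lt_exp (C * (2 * A / eta) `^ p) kpd.
have n0R : 0 < n%:R :> R by rewrite ltr0n.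
pose L := (k * r * n)%N.
have L0 : 0 < L%:R :> R by rewrite ltr0n !muln_gt0 k0 n0.
pose h := H / L%:R.
have h0 : 0 < h by rewrite divr_gt0.
have kh0 : 0 < k%:R * h by rewrite mulr_gt0.
have LhH : L%:R * h = H by rewrite /h mulrC divfK ?gt_eqF.
have khn : k%:R * h * n%:R = H / r%:R.
  rewrite -LhH /L !natrM; field; rewrite gt_eqF//.
(* with this threshold the linear term absorbs half of [eta] *)
pose lam := eta / (2 * A * n%:R ^+ k).
have nk0 : 0 < n%:R ^+ k :> R by rewrite exprn_gt0.
have lam0 : 0 < lam by rewrite divr_gt0// !mulr_gt0.
pose th (t : {ffun 'I_d -> 'I_n}) := lattice_pt (k%:R * h) (fun c => t c).
have low t : eta <= `|fdiff H s G (x + th t)|.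
  have : `|fdiff H s G (x + th t) - fdiff H s G x| < eta.
    apply: rhoP => // c; rewrite !mxE addrAC subrr add0r.
    rewrite ger0_norm; last by rewrite mulr_ge0// ltW.
    apply: le_lt_trans Hr; rewrite -khn (ler_pM2l kh0).
    by rewrite ler_nat ltnW.
  have := lerB_dist (fdiff H s G x) (fdiff H s G (x + th t)).
  by rewrite distrC /eta; lra.
have := @fdiff_refine R d _ th h L (2 ^+ k * (lam * ((n ^ d)%:R + C * lam^-1 `^ p)))
  s G x (ltW h0).
rewrite LhH => /(_ _)/[dup] up _.
have {}up : \sum_t `|fdiff H s G (x + th t)| <= L%:R ^+ size s *
    (2 ^+ k * (lam * ((n ^ d)%:R + C * lam^-1 `^ p))).
  apply: up => w wx; apply: sum_fdiff_le => // c.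
  have [x0 x1] := xu c; have := wx c; rewrite khn.
  have : H / r%:R <= H by rewrite ler_pdivrMr// ler_peMr// ltW.
  by move=> ? /andP[? ?]; split; lra.
have {low up} := le_trans (ler_sum _ (fun t _ => low t)) up.
rewrite sumr_const card_ffun !card_ord sk -[X in X <= _]mulr_natl.
have -> : L%:R ^+ k * (2 ^+ k * (lam * ((n ^ d)%:R + C * lam^-1 `^ p))) =
    eta / 2 * ((n ^ d)%:R + C * lam^-1 `^ p).
  rewrite /lam /L natrM; have -> : A = 2 ^+ k * (k * r)%:R ^+ k by rewrite /A exprMn.
  rewrite exprMn; set q := (k * r)%:R ^+ k; set m := n%:R ^+ k; set u := 2 ^+ k.
  have q0 : q != 0 by rewrite expf_neq0// pnatr_eq0 -lt0n muln_gt0 k0.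
  have u0 : u != 0 by rewrite expf_neq0.
  have m0 : m != 0 by rewrite gt_eqF.
  by field; rewrite u0 q0 m0.
have -> : lam^-1 `^ p = (2 * A / eta) `^ p * (n%:R ^+ k) `^ p.
  rewrite -powRM; first by congr (_ `^ _); rewrite /lam invf_div mulrAC.
    by rewrite divr_ge0 ?mulr_ge0// ltW.
  exact: ltW.
move: nK; rewrite natrX mulrA; set X := n%:R ^+ d; set Y := C * _ * _ => YX.
by move: (X) (Y) YX => X' Y' YX; nra.
Qed.

Lemma peval_bounded (R : realType) (d : nat) (m : mpoly.mpoly d R) :
  exists B : R, forall x, @unit_cube R d x -> `|peval m x| <= B.
Proof.
exists (\sum_(c <- mpoly.msupp m) `|mpoly.mcoeff c m|) => x xu.
rewrite /peval mpoly.mevalE (le_trans (ler_norm_sum _ _ _))//.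
apply: ler_sum => c _; rewrite normrM ler_piMr// normr_prod.
apply: prodr_ile1 => i _; have /andP[x0 x1] := xu i.
by rewrite normr_ge0/= normrX (ger0_norm x0) exprn_ile1.
Qed.

Lemma peval_lip_unit (R : realType) (d : nat) (m : mpoly.mpoly d R) :
  exists2 K : R, 0 <= K & forall (x y : 'rV[R]_d) (delta : R),
    unit_cube x -> unit_cube y ->
    (forall i, `|x ord0 i - y ord0 i| <= delta) ->
    `|peval m x - peval m y| <= K * delta.
Proof.
have [B mB] := peval_bounded m.
have [K K0 HK] := @peval_lip_box R d (mpoly.msize m).+1 isT.
exists (K * `|B|) => [|x y delta xu yu xy]; first by rewrite mulr_ge0.
have mB' x' : box 0 1 x' -> `|peval m x'| <= `|B|.
  by rewrite -unit_cube_box => /mB/le_trans; apply; exact: ler_norm.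
have := HK m (leqW (leqnn _)) 0 1 `|B| ltr01 mB' x y delta.
by rewrite -unit_cube_box divr1; exact.
Qed.

Lemma continuous_eq_peval (R : realType) (d : nat) (F : 'rV[R]_d -> R)
    (x : 'rV[R]_d) (m : mpoly.mpoly d R) :
  (forall y, limit_along F setT y (F y)) -> unit_cube x ->
  (forall rho : R, 0 < rho -> exists y, [/\ unit_cube y,
     forall i, `|y ord0 i - x ord0 i| < rho & F y = peval m y]) ->
  F x = peval m x.
Proof.
move=> Fc xu dense; apply/eqP; rewrite -subr_eq0 -normr_le0.
apply/ler_addgt0Pl => e e0; rewrite addr0.
have e2 : 0 < e / 2 by lra.
have [delta delta0 FP] := Fc x _ e2.
have [K K0 mK] := peval_lip_unit m.
have rho0 : 0 < Num.min delta (e / 2 / (K + 1)).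
  by rewrite lt_min delta0 divr_gt0// ltr_wpDl.
have [y [yu yx Fy]] := dense _ rho0.
have F1 : `|F y - F x| < e / 2.
  by apply: FP => // i; have := yx i; rewrite lt_min => /andP[].
have m1 : `|peval m y - peval m x| <= K * (e / 2 / (K + 1)).
  apply: mK => // i; have := yx i; rewrite lt_min => /andP[_ ?]; exact: ltW.
have m2 : K * (e / 2 / (K + 1)) <= e / 2.
  by rewrite mulrA ler_pdivrMr ?ltr_wpDl//; nra.
have := ler_distD (F y) (F x) (peval m x); rewrite (distrC (F x) (F y)) {2}Fy; lra.
Qed.

(** The interpolation polynomials of [G] on the grids of mesh [1 / N] agree with
    [G] there because their difference has zero [k]-th differences; as the grid
    of mesh [1 / k] already determines a polynomial of degree less than [k],
    they are all equal, and [G] coincides with it on a dense set. *)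
Lemma polynomial_of_variation (R : realType) (d k : nat) (p C : R)
    (G : 'rV[R]_d -> R) :
  (0 < k)%N -> 1 <= p -> k%:R * p < d%:R -> cube_variation_le k p C G ->
  (forall y, limit_along G setT y (G y)) ->
  exists2 m, @poly_space R d k m & forall x, unit_cube x -> G x = peval m x.
Proof.
move=> k0 p1 kpd GC Gc.
have grid N : (0 < N)%N -> exists2 m, @poly_space R d k m & forall g,
    (forall c, g c < N)%N -> G (lattice_pt N%:R^-1 g) = peval m (lattice_pt N%:R^-1 g).
  move=> N0; have N0R : 0 < N%:R :> R by rewrite ltr0n.
  have h0 : N%:R^-1 != 0 :> R by rewrite invr_neq0// gt_eqF.
  have [m mk mG] := newton_interpolation h0 k (fun g => G (lattice_pt N%:R^-1 g)).
  exists m => // g gN; apply/eqP; rewrite -subr_eq0; apply/eqP.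
  apply: (@lattice_eq0 R d N%:R^-1 k N (fun x => G x - peval m x)) gN.
    move=> s g' sk g'N; rewrite fdiffB (vanishing_fdiff_peval _ mk sk) subr0.
    apply: (fdiff_eq0_of_variation k0 p1 kpd GC Gc _ sk) => [|c].
      by rewrite invr_gt0.
    rewrite mxE mulr_ge0 ?invr_ge0 ?(ltW N0R)//; split=> //.
    rewrite -mulrDr -natrD -[X in _ + X]mulr1 -mulrDr natr1 mulrC.
    by rewrite ler_pdivrMr// mul1r ler_nat.
  by move=> g' g'k; rewrite mG// subrr.
have [m mk mG] := grid k k0; exists m => // x xu.
apply: continuous_eq_peval => // rho rho0.
pose M := (Num.Def.trunc rho^-1).+1; pose N := (k * M)%N.
have N0 : (0 < N)%N by rewrite muln_gt0 k0.
have N0R : 0 < N%:R :> R by rewrite ltr0n.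
have k0R : 0 < k%:R :> R by rewrite ltr0n.
have M0R : 0 < M%:R :> R by rewrite ltr0n.
have Nrho : N%:R^-1 < rho.
  rewrite invf_plt ?posrE//; apply: lt_le_trans (truncnS_gt _) _.
  by rewrite ler_nat leq_pmull.
have [m' m'k m'G] := grid N N0.
have mm' g : peval m (lattice_pt N%:R^-1 g) = peval m' (lattice_pt N%:R^-1 g).
  have -> : lattice_pt N%:R^-1 g = M%:R^-1 *: lattice_pt k%:R^-1 g :> 'rV[R]_d.
    by apply/rowP => c; rewrite !mxE mulrA natrM invfM mulrC (mulrC M%:R^-1) mulrC.
  apply/eqP; rewrite -subr_eq0 /peval -mpoly.mevalB; apply/eqP.
  apply: (@peval_lattice_eq0 _ _ k%:R^-1 k) => [|g' g'k].
    rewrite /poly_space /= (leq_trans (mpoly.msizeD_le _ _))// geq_max mpoly.msizeN.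
    by rewrite (mk : (_ <= _)%N) (m'k : (_ <= _)%N).
  have g'lt c : (g' c < k)%N.
    by apply: leq_ltn_trans g'k; rewrite (bigD1 c)//= leq_addr.
  rewrite /peval mpoly.mevalB -!/(peval _ _) -mG//.
  have -> : lattice_pt k%:R^-1 g' = lattice_pt N%:R^-1 (fun c => M * g' c)%N :> 'rV[R]_d.
    apply/rowP => c; rewrite !mxE natrM mulrA natrM invfM -(mulrA k%:R^-1).
    by rewrite mulVf ?mulr1// gt_eqF.
  rewrite -m'G ?subrr// => c.
  by rewrite mulnC ltn_mul2r g'lt.
(* rounding down keeps the upper ends of the cube within the half-open grid *)
pose g c := minn (Num.Def.trunc (x ord0 c * N%:R)) N.-1.
have gN c : (g c < N)%N by rewrite -(prednK N0) ltnS geq_minr.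
have gx c : 0 <= x ord0 c - N%:R^-1 * (g c)%:R <= N%:R^-1.
  have /andP[x0 x1] := xu c.
  have xN : 0 <= x ord0 c * N%:R by rewrite mulr_ge0// ltW.
  have gl : (g c)%:R <= x ord0 c * N%:R.
    apply: le_trans (_ : (Num.Def.trunc (x ord0 c * N%:R))%:R <= _).
      by rewrite ler_nat geq_minl.
    by rewrite truncn_le.
  have gu : x ord0 c * N%:R <= (g c)%:R + 1.
    rewrite natr1 /g /minn; case: ifP => _; first exact/ltW/truncnS_gt.
    by rewrite prednK// ler_piMl// ltW.
  have E : x ord0 c = N%:R^-1 * (x ord0 c * N%:R).
    by rewrite mulrCA mulVf ?mulr1// gt_eqF.
  rewrite {1 2}E -mulrBr; apply/andP; split.
    by rewrite mulr_ge0 ?invr_ge0 ?(ltW N0R)// subr_ge0.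
  by rewrite ler_piMr ?invr_ge0 ?(ltW N0R)//; lra.
exists (lattice_pt N%:R^-1 g); split.
- move=> c; have := gx c; rewrite !mxE => /andP[g1 g2].
  have /andP[x0 x1] := xu c; rewrite mulr_ge0 ?invr_ge0 ?(ltW N0R)//=; lra.
- move=> c; rewrite distrC mxE ger0_norm; have /andP[g1 g2] := gx c => //.
  exact: le_lt_trans Nrho.
- by rewrite mm'; exact: m'G.
Qed.

(** * Splitting off the jumps *)

(** The projection onto the cube turns a function continuous on the cube
    into one continuous everywhere. *)
Definition clamp (R : realType) (d : nat) (x : 'rV[R]_d) : 'rV[R]_d :=
  \row_i Num.max 0 (Num.min 1 (x ord0 i)).

Lemma clamp_unit (R : realType) (d : nat) (x : 'rV[R]_d) : unit_cube (clamp x).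
Proof.
by move=> i; rewrite mxE le_max lexx ge_max ler01 ge_min lexx.
Qed.

Lemma clamp_id (R : realType) (d : nat) (x : 'rV[R]_d) :
  unit_cube x -> clamp x = x.
Proof.
move=> xu; apply/rowP => i; rewrite mxE; have /andP[x0 x1] := xu i.
by rewrite (min_idPr x1) (max_idPr x0).
Qed.

Lemma clamp_dist (R : realType) (d : nat) (x y : 'rV[R]_d) i :
  `|clamp x ord0 i - clamp y ord0 i| <= `|x ord0 i - y ord0 i|.
Proof.
rewrite !mxE; set a := x _ _; set b := y _ _; rewrite ler_norml.
have := ler_norm (a - b); have := ler_norm (b - a); rewrite (distrC b).
by case: (lerP 1 a) => ?; case: (lerP 1 b) => ?;
  rewrite ?(max_idPr (@ler01 R)); try case: (lerP 0 a) => ?;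
  try case: (lerP 0 b) => ?; move=> *; apply/andP; split; lra.
Qed.

Lemma exists_near_neq_box (R : realType) (d : nat) (a x : 'rV[R]_d)
    (r delta : R) : (0 < d)%N -> 0 < r -> box a r x -> 0 < delta ->
  exists y, [/\ box a r y, y != x &
    forall i, `|y ord0 i - x ord0 i| < delta].
Proof.
move=> d0 r0 xb delta0; pose o : 'I_d := Ordinal d0.
have := xb o => /andP[x1 x2].
have [||u [u01 ux ud]] := @exists_near_neq R ((x ord0 o - a ord0 o) / r) (delta / r).
- by rewrite divr_ge0 ?ler_pdivrMr//=; lra.
- exact: divr_gt0.
have E : x ord0 o = a ord0 o + (x ord0 o - a ord0 o) / r * r.
  by rewrite divfK ?gt_eqF//; lra.
exists (\row_i if i == o then a ord0 o + u * r else x ord0 i); split.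
- move=> i; rewrite mxE; case: eqP => [->|_]; last exact: xb.
  by apply/andP; split; nra.
- apply/eqP => /rowP/(_ o); rewrite mxE eqxx E => /addrI/(mulIf (lt0r_neq0 r0)).
  exact/eqP.
move=> i; rewrite mxE; case: eqP => [->|_]; last by rewrite subrr normr0.
rewrite E opprD addrACA subrr add0r -mulrBl normrM (gtr0_norm r0).
by rewrite -ltr_pdivlMr.
Qed.

Definition punctured_limit_fun (R : realType) (d : nat) (F G : 'rV[R]_d -> R) :=
  forall x, unit_cube x ->
    limit_along F [set y | unit_cube y /\ y != x] x (G x).

(** Punctured limits of a function always form a continuous function. *)
Lemma regularization (R : realType) (d k : nat) (p C M : R)
    (F : 'rV[R]_d -> R) : (2 <= d)%N -> (0 < k)%N ->
  cube_variation_le k p C F -> (forall x, unit_cube x -> `|F x| <= M) ->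
  exists2 G : 'rV[R]_d -> R, (forall y, limit_along G setT y (G y)) &
    punctured_limit_fun F G.
Proof.
move=> d2 k0 FC FM.
have H (x : 'rV[R]_d) := punctured_limit d2 k0 FC FM (clamp_unit x).
pose G x := sval (cid (H x)).
have GP x : limit_along F [set y | unit_cube y /\ y != clamp x] (clamp x) (G x).
  exact: (svalP (cid (H x))).
exists G; last by move=> x xu; rewrite -{1 2}(clamp_id xu).
move=> x e e0; have e2 : 0 < e / 2 by lra.
have [delta delta0 xP] := GP x _ e2.
exists (delta / 2) => [|y _ yx]; first by lra.
have [dl dl0 yP] := GP y _ e2.
have yxc i : `|clamp y ord0 i - clamp x ord0 i| < delta / 2.
  exact: le_lt_trans (clamp_dist _ _ _) (yx i).
have Gxx : clamp y = clamp x -> G y = G x.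
  move=> E; rewrite /G; move: (H x) (H y); rewrite E => Hx Hy.
  by rewrite (Prop_irrelevance Hx Hy).
have [/Gxx ->|yxn] := eqVneq (clamp y) (clamp x); first by rewrite subrr normr0.
have [c cyx] : exists c, clamp y ord0 c != clamp x ord0 c.
  apply/existsP; apply: contraNT yxn; rewrite negb_exists => /forallP h.
  by apply/eqP/rowP => c; have := h c; rewrite negbK => /eqP.
pose rho := Num.min dl (Num.min (delta / 2) `|clamp y ord0 c - clamp x ord0 c|).
have rho0 : 0 < rho.
  by rewrite !lt_min dl0 normr_gt0 subr_eq0 cyx andbT; lra.
have ybox : box 0 1 (clamp y) by rewrite -unit_cube_box; exact: clamp_unit.
have [z [zb zy zn]] := exists_near_neq_box (ltnW d2) ltr01 ybox rho0.
have zu : unit_cube z by rewrite unit_cube_box.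
have z1 : `|F z - G y| < e / 2.
  by apply: yP => // i; have := zn i; rewrite !lt_min => /andP[].
have z2 : `|F z - G x| < e / 2.
  apply: xP; [split => //|].
    apply/eqP => zx; have := zn c; rewrite zx !lt_min => /and3P[_ _].
    by rewrite distrC ltxx.
  move=> i; have := zn i; rewrite !lt_min => /and3P[_ zi _].
  by have := yxc i; have := ler_distD (clamp y ord0 i) (z ord0 i) (clamp x ord0 i); lra.
by have := ler_distD (F z) (G y) (G x); rewrite (distrC (G y) (F z)); lra.
Qed.

(** A bound that holds on a box passes to the limit, since each point of the box is
    a limit of other points of the box. *)
Lemma punctured_limit_fun_le (R : realType) (d : nat) (F G : 'rV[R]_d -> R)
    (a : 'rV[R]_d) (r B : R) (m : mpoly.mpoly d R) : (0 < d)%N ->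
  punctured_limit_fun F G -> 0 < r -> box a r `<=` @unit_cube R d ->
  (forall x, box a r x -> `|F x - peval m x| <= B) ->
  forall x, box a r x -> `|G x - peval m x| <= B.
Proof.
move=> d0 FG r0 bu FB x xb; have xu := bu _ xb.
apply/ler_addgt0Pl => e e0; have e2 : 0 < e / 2 by lra.
have [delta delta0 FP] := FG x xu _ e2.
have [K K0 mK] := peval_lip_unit m.
have rho0 : 0 < Num.min delta (e / 2 / (K + 1)).
  by rewrite lt_min delta0 divr_gt0// ltr_wpDl.
have [y [yb yx yn]] := exists_near_neq_box d0 r0 xb rho0.
have F1 : `|F y - G x| < e / 2.
  by apply: FP => [|i]; [split => //; exact: bu
    | have := yn i; rewrite lt_min => /andP[]].
have m1 : `|peval m y - peval m x| <= K * (e / 2 / (K + 1)).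
  apply: mK => // [|i]; first exact: bu.
  have := yn i; rewrite lt_min => /andP[_ ?]; exact: ltW.
have m2 : K * (e / 2 / (K + 1)) <= e / 2.
  by rewrite mulrA ler_pdivrMr ?ltr_wpDl//; nra.
have := FB y yb; move: F1 m1; rewrite distrC.
have := ler_normD (G x - F y) ((F y - peval m y) + (peval m y - peval m x)).
have := ler_normD (F y - peval m y) (peval m y - peval m x).
have -> : G x - F y + ((F y - peval m y) + (peval m y - peval m x)) =
  G x - peval m x by ring.
lra.
Qed.

Lemma cube_variation_limit (R : realType) (d k : nat) (p C : R)
    (F G : 'rV[R]_d -> R) : (0 < d)%N -> punctured_limit_fun F G ->
  cube_variation_le k p C F -> cube_variation_le k p C G.
Proof.
move=> d0 FG FC I a r e r0 bu sep e0 He; apply: (FC I a r e) => // i m mk B FB.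
by apply: (He i m mk); apply: punctured_limit_fun_le FB.
Qed.

(** If [m] is within [B] of [F] on a box around [x], it is within [B] of the
    limit of [F] at [x] too, so half of the jump of [F] at [x] bounds from
    below the error on the box. *)
Lemma sum_jumps_le (R : realType) (d k : nat) (p C : R) (F G : 'rV[R]_d -> R)
    (I : finType) (x : I -> 'rV[R]_d) : (0 < d)%N ->
  punctured_limit_fun F G -> cube_variation_le k p C F ->
  injective x -> (forall i, unit_cube (x i)) ->
  \sum_i (`|F (x i) - G (x i)| / 2) `^ p <= C.
Proof.
move=> d0 FG FC xI xu; have [h h01 sep] := separated_corner_boxes xI xu.
have hh : 0 <= h <= 1 by lra.
have h0 : 0 < h by lra.
have xb i : box (corner_box h (x i)) h (x i) by exact: corner_box_mem.
have bu i : box (corner_box h (x i)) h `<=` @unit_cube R d by exact: corner_box_sub.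
apply: (FC I (fun i => corner_box h (x i)) (fun=> h)
   (fun i => `|F (x i) - G (x i)| / 2)) => // [|i m mk B FB].
  by apply: sep; lra.
have := punctured_limit_fun_le d0 FG h0 (bu i) FB (xb i).
have := FB _ (xb i).
by have := ler_distD (peval m (x i)) (F (x i)) (G (x i)); rewrite (distrC (peval m _)); lra.
Qed.

(** * The space of p-summable functions *)

Lemma lp_spaceP (R : realType) (d : nat) (p : R) (f : cube_pt R d -> R) :
  1 <= p -> lp_space p f <->
  exists S : R, forall r : seq (cube_pt R d), uniq r ->
    \sum_(x <- r) `|f x| `^ p <= S.
Proof.
move=> p1; have p0 : p^-1 != 0 by rewrite invr_eq0; lra.
rewrite /lp_space /lp_norm /=; set T := (\esum_(_ in _) _)%E.
have T0 : (0 <= T)%E by apply: esum_ge0 => x _; rewrite lee_fin powR_ge0.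
split=> [/(lty_poweRy p0) Ty|[S fS]].
  have Tfin : T \is a fin_num by rewrite ge0_fin_numE.
  exists (fine T) => r ur; rewrite -lee_fin fineK// -sumEFin.
  apply: le_ereal_sup_tmp; exists (\sum_(x \in [set` r]) (`|f x| `^ p)%:E)%E.
    by exists [set` r] => //; split => //; exact: finite_seq.
  by rewrite -fsbig_seq.
apply: poweR_lty; apply: (@le_lt_trans _ _ S%:E); last exact: ltry.
apply/ereal_supP => _ [A [Afin _] <-].
rewrite fsbig_finite//= sumEFin lee_fin; apply: fS.
exact: finmap.fset_uniq.
Qed.

Lemma powRD_le (R : realType) (p x y : R) : 0 <= p -> 0 <= x -> 0 <= y ->
  (x + y) `^ p <= 2 `^ p * (x `^ p + y `^ p).
Proof.
move=> p0; wlog xy : x y / x <= y.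
  move=> W x0 y0; have [|/ltW] := leP x y => h; first exact: W.
  by rewrite addrC [X in _ * X]addrC; exact: W.
move=> x0 y0; apply: (@le_trans _ _ ((2 * y) `^ p)).
  by apply: ge0_ler_powR; rewrite ?nnegrE ?addr_ge0 ?mulr_ge0//; lra.
by rewrite powRM// ler_wpM2l ?powR_ge0// lerDr powR_ge0.
Qed.

Lemma lp_space_submod (R : realType) (d : nat) (p : R) : 1 <= p ->
  submod_closed (mem (@lp_space R d p)).
Proof.
move=> p1; have p0 : 0 <= p by lra.
split=> [|a u v]; rewrite !inE.
  apply/lp_spaceP => //; exists 0 => r _; rewrite big1// => x _.
  by rewrite normr0 powR0//; lra.
move=> /(lp_spaceP _ p1)[S uS] /(lp_spaceP _ p1)[T vT].
apply/(lp_spaceP _ p1); exists (2 `^ p * (`|a| `^ p * S + T)) => r ur.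
apply: (@le_trans _ _ (\sum_(x <- r) 2 `^ p * (`|a| `^ p * `|u x| `^ p + `|v x| `^ p))).
  apply: ler_sum => x _; rewrite -powRM//.
  have := powRD_le p0 (mulr_ge0 (normr_ge0 a) (normr_ge0 (u x)))
    (normr_ge0 (v x)).
  apply: le_trans.
  apply: ge0_ler_powR; rewrite ?nnegrE ?addr_ge0 ?mulr_ge0//.
  by rewrite -normrM; exact: ler_normD.
rewrite -mulr_sumr big_split/= -mulr_sumr ler_wpM2l ?powR_ge0//.
by apply: lerD; [rewrite ler_wpM2l ?powR_ge0// uS|exact: vT].
Qed.

Lemma polynomial_funs_submod (R : realType) (d k : nat) :
  submod_closed (mem (@polynomial_funs R d k)).
Proof.
split=> [|a u v]; rewrite !inE.
  exists 0; first by rewrite /poly_space /= mpoly.msize0.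
  by apply/funext => x; rewrite /peval mpoly.meval0.
move=> [m mk <-] [m' m'k <-]; exists (a *: m + m').
  rewrite /poly_space /= (leq_trans (mpoly.msizeD_le _ _))// geq_max.
  by rewrite (leq_trans (mpoly.msizeZ_le _ _)).
by apply/funext => x; rewrite /peval mpoly.mevalD mpoly.mevalZ.
Qed.

(** A polynomial that is nonzero somewhere on the cube is bounded away from
    zero at infinitely many points of it. *)
Lemma lp_polynomial_eq0 (R : realType) (d k : nat) (p : R)
    (f : cube_pt R d -> R) : (0 < d)%N -> 1 <= p -> lp_space p f ->
  polynomial_funs k f -> f = 0.
Proof.
move=> d0 p1 /(lp_spaceP _ p1)[S fS] [m mk mf].
apply/funext => x0; apply/eqP; apply: contraT => fx0.
have {fx0}c0 : 0 < `|f x0| / 2 by rewrite divr_gt0// normr_gt0.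
have [K K0 mK] := peval_lip_unit m.
set c := `|f x0| / 2 in c0 *.
pose eta := Num.min 1 (c / (K + 1)).
have eta0 : 0 < eta by rewrite lt_min ltr01 divr_gt0// ltr_wpDl.
have eta1 : eta <= 1 by rewrite ge_min lexx.
have etac : K * eta <= c.
  apply: (@le_trans _ _ (K * (c / (K + 1)))).
    by rewrite ler_wpM2l// ge_min lexx orbT.
  by rewrite mulrA ler_pdivrMr ?ltr_wpDl//; nra.
pose o : 'I_d := Ordinal d0.
pose x := set_val x0; have xu : unit_cube x := unit_cube_val x0.
pose u := corner eta (x ord0 o).
have u0 : 0 <= u := corner_ge0 _ _.
have u1 : u + eta <= 1 := corner_le1 _ eta1.
have ux : u <= x ord0 o <= u + eta.
  apply: corner_near; [exact: eta1|exact: xu|].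
  by rewrite subrr normr0; lra.
have cp0 : 0 < c `^ p by exact: powR_gt0.
pose n := (Num.Def.trunc (`|S| / c `^ p)).+1.
have n0 : 0 < n%:R :> R by rewrite ltr0n.
pose y (j : nat) : 'rV[R]_d :=
  \row_i (if i == o then u + eta * (j%:R / n%:R) else x ord0 i).
have yo j : y j ord0 o = u + eta * (j%:R / n%:R) by rewrite mxE eqxx.
have jn01 (j : 'I_n) : 0 <= (j%:R / n%:R : R) <= 1.
  by rewrite divr_ge0//= ler_pdivrMr// mul1r ler_nat ltnW.
have yu (j : 'I_n) : unit_cube (y j).
  move=> i; rewrite mxE; case: eqP => _; last exact: xu.
  by have := jn01 j; nra.
have Y (j : 'I_n) := cid (unit_cubeP (yu j)).
pose z j := projT1 (Y j).
have zE j : set_val (z j) = y j := projT2 (Y j).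
have z_inj : injective z.
  move=> i j zij; have : y i = y j by rewrite -!zE zij.
  move=> /rowP/(_ o); rewrite !yo => /addrI/(mulfI (lt0r_neq0 eta0)).
  move=> /(mulIf (invr_neq0 (lt0r_neq0 n0)))/eqP; rewrite eqr_nat => /eqP.
  exact: val_inj.
have fz j : c <= `|f (z j)|.
  have : `|peval m (y j) - peval m x| <= K * eta.
    apply: mK => // i; rewrite mxE; case: eqP => [->|_].
      by have := jn01 j; rewrite ler_norml => ?; apply/andP; split; nra.
    by rewrite subrr normr0 ltW.
  have <- : f x0 = peval m x by rewrite -mf.
  have <- : f (z j) = peval m (y j) by rewrite -mf zE.
  have := lerB_dist (f x0) (f (z j)); rewrite distrC.
  have -> : `|f x0| = 2 * c by rewrite /c mulrC divfK.
  lra.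
have := fS [seq z j | j <- enum 'I_n].
rewrite map_inj_uniq// enum_uniq => /(_ isT); rewrite big_map big_enum /=.
apply: contraTT => _; rewrite -ltNge.
apply: (@lt_le_trans _ _ (n%:R * c `^ p)).
  rewrite -ltr_pdivrMr//; apply: le_lt_trans (truncnS_gt _).
  by rewrite ler_pM2r ?invr_gt0// ler_norm.
rewrite -[X in X%:R](card_ord n) mulr_natl -sumr_const.
apply: ler_sum => j _; apply: ge0_ler_powR; rewrite ?nnegrE//; first lra.
exact: ltW.
Qed.

Lemma open_box_interior (R : realType) (d : nat) (a z : 'rV[R]_d) (r : R) :
  (forall i, a ord0 i < z ord0 i < a ord0 i + r) -> (box a r)° z.
Proof.
move=> az; pose g i := Num.min (z ord0 i - a ord0 i) (a ord0 i + r - z ord0 i).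
have g0 i : 0 < g i by rewrite lt_min; have := az i; lra.
have [e [e0 _ eg]] := finite_pos_lbound g0.
apply/nbhs_rowP; exists e => // y yz i; have := yz i; have := eg i.
by rewrite le_min ltr_norml; lra.
Qed.

(** One of the [2 ^ d] orthants at [x] into which a box [Q] containing [x]
    extends, the positive direction being preferred in each coordinate. *)
Definition orthant (R : realType) (d : nat) (x : 'rV[R]_d)
    (Q : set 'rV[R]_d) : {ffun 'I_d -> bool} :=
  [ffun i => `[< exists y, Q y /\ x ord0 i < y ord0 i >]].

Lemma orthant_box (R : realType) (d : nat) (x a : 'rV[R]_d) (r : R) i :
  0 < r -> box a r x ->
  orthant x (box a r) i = (x ord0 i < a ord0 i + r).
Proof.
move=> r0 xb; rewrite ffunE; apply/asboolP/idP => [[y [yb xy]]|xa].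
  by have /andP[_] := yb i; exact: lt_le_trans.
exists (a + const_mx r); split; last by rewrite !mxE.
by move=> j; rewrite !mxE; lra.
Qed.

Lemma same_orthant_interiors (R : realType) (d : nat) (x a b : 'rV[R]_d)
    (r s : R) : 0 < r -> 0 < s -> box a r x -> box b s x ->
  orthant x (box a r) = orthant x (box b s) ->
  exists z, (box a r)° z /\ (box b s)° z.
Proof.
move=> r0 s0 xa xb ab.
pose z : 'rV[R]_d := \row_i (if orthant x (box a r) i
  then x ord0 i + Num.min (a ord0 i + r - x ord0 i) (b ord0 i + s - x ord0 i) / 2
  else x ord0 i - Num.min r s / 2).
exists z; split; apply: open_box_interior => i.
  have := congr1 (fun t : {ffun 'I_d -> bool} => t i) ab.
  rewrite mxE !orthant_box//.
  have /andP[a1 a2] := xa i; have /andP[b1 b2] := xb i.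
  case: (ltrP (x ord0 i) (a ord0 i + r)) => xar;
    case: (ltrP (x ord0 i) (b ord0 i + s)) => xbs // _;
    case: (lerP r s) => ?;
    case: (lerP (a ord0 i + r - x ord0 i) (b ord0 i + s - x ord0 i)) => ?;
    apply/andP; split; lra.
have := congr1 (fun t : {ffun 'I_d -> bool} => t i) ab.
rewrite mxE !orthant_box//.
have /andP[a1 a2] := xa i; have /andP[b1 b2] := xb i.
case: (ltrP (x ord0 i) (a ord0 i + r)) => xar;
  case: (ltrP (x ord0 i) (b ord0 i + s)) => xbs // _;
  case: (lerP r s) => ?;
  case: (lerP (a ord0 i + r - x ord0 i) (b ord0 i + s - x ord0 i)) => ?;
  apply/andP; split; lra.
Qed.

(** Choose in each cube [Q] of a packing a point [x Q]. A point may be chosen for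
    several cubes, but the cubes with the same orthant at [x Q] have different
    points, because their interiors would meet otherwise; hence it is chosen
    at most [2 ^ d] times. *)
Lemma sum_packing_le (R : realType) (d : nat) (pi : set (set 'rV[R]_d))
    (x : set 'rV[R]_d -> cube_pt R d) (F : cube_pt R d -> R) (S : R) :
  finite_packing pi -> (forall Q, pi Q -> Q (set_val (x Q))) ->
  (forall r, uniq r -> \sum_(y <- r) F y <= S) ->
  \sum_(Q <- finmap.enum_fset (fset_set pi)) F (x Q) <= (2 ^ d)%:R * S.
Proof.
move=> [pifin picube pitriv] xQ FS.
set s := finmap.enum_fset _.
have sP Q : Q \in s -> pi Q by rewrite in_fset_set// inE.
pose sg Q := orthant (set_val (x Q)) Q.
rewrite (partition_big sg xpredT)//=.
apply: (@le_trans _ _ (\sum_(t : {ffun 'I_d -> bool}) S)); last first.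
  by rewrite sumr_const card_ffun card_bool card_ord mulr_natl.
apply: ler_sum => t _; rewrite -big_filter -(big_map x xpredT F); apply: FS.
rewrite map_inj_in_uniq ?filter_uniq ?finmap.fset_uniq// => Q Q'.
rewrite !mem_filter => /andP[/eqP Qt /sP Qpi] /andP[/eqP Q't /sP Q'pi] xQQ'.
apply: pitriv => //.
have [[a [r [r0 QE]]] _] := (fun H => (is_cubeP H.1, H.2)) (picube Q Qpi).
have [[b [r' [r'0 Q'E]]] _] := (fun H => (is_cubeP H.1, H.2)) (picube Q' Q'pi).
rewrite QE Q'E; apply: (same_orthant_interiors (x := set_val (x Q))) => //.
- by rewrite -QE; exact: xQ.
- by rewrite xQQ' -Q'E; exact: xQ.
- by rewrite -QE -Q'E -[LHS]/(sg Q) Qt -Q't /sg xQQ'.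
Qed.

(** * The decomposition *)

(** The error is at most the supremum of [|f - m|] on the box, which need not be
    attained; the factor two leaves room for a point. *)
Lemma approx_error_le_twice (R : realType) (d k : nat)
    (f : cube_pt R d -> R) (m : mpoly.mpoly d R) (a : 'rV[R]_d) (r M : R) :
  poly_space k m -> (forall x, `|f x - peval m (set_val x)| <= M) ->
  0 < r -> box a r `<=` @unit_cube R d ->
  exists2 x : cube_pt R d, box a r (set_val x) &
    (approx_error k f (box a r) <= (2 * `|f x - peval m (set_val x)|)%:E)%E.
Proof.
move=> mk fM r0 bu; pose g x := `|f x - peval m (set_val x)|.
set E := approx_error k f (box a r).
have E0 : (0 <= E)%E by exact: approx_error_ge0.
have Esup (B : R) : (forall x : cube_pt R d, box a r (set_val x) -> g x <= B) ->
    (E <= B%:E)%E.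
  move=> gB; apply: ge_ereal_inf; eexists; first by exists m.
  by apply/ereal_supP => _ [x xb <-]; rewrite lee_fin; exact: gB.
have EM : (E <= M%:E)%E by apply: (Esup) => x _; exact: fM.
have Efin : E \is a fin_num by rewrite ge0_fin_numE// (le_lt_trans EM)// ltry.
have [y ya] : exists y : cube_pt R d, set_val y = a.
  by apply: unit_cubeP; apply: bu => i; lra.
apply: contrapT => H.
have small (x : cube_pt R d) : box a r (set_val x) -> 2 * g x < fine E.
  move=> xb; rewrite ltNge; apply/negP => gx; apply: H; exists x => //.
  by rewrite -/E -(fineK Efin) lee_fin.
have : (E <= (fine E / 2)%:E)%E.
  by apply: Esup => x /small; lra.
rewrite -{1}(fineK Efin) lee_fin.
have ay : box a r (set_val y) by rewrite ya => i; lra.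
by have := small y ay; have := normr_ge0 (f y - peval m (set_val y)); rewrite /g; lra.
Qed.

Lemma V_space_lp_add_polynomial (R : realType) (d k : nat) (p : R)
    (f : cube_pt R d -> R) (m : mpoly.mpoly d R) : 1 <= p -> poly_space k m ->
  lp_space p (fun x => f x - peval m (set_val x)) -> V_space k p f.
Proof.
move=> p1 mk /(lp_spaceP _ p1)[S gS]; have p0 : 0 < p by lra.
pose g x := f x - peval m (set_val x).
have S0 : 0 <= S by have := gS [::] isT; rewrite big_nil.
have gM x : `|g x| <= S `^ p^-1.
  have -> : `|g x| = (`|g x| `^ p) `^ p^-1.
    by rewrite -powRrM mulfV ?gt_eqF// powRr1.
  apply: ge0_ler_powR; rewrite ?nnegrE ?powR_ge0 ?invr_ge0 ?(ltW p0)//.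
  by have := gS [:: x] isT; rewrite big_seq1.
split.
  have [B mB] := peval_bounded m.
  exists (S `^ p^-1 + B); split; first exact: num_real.
  move=> M SM x _; apply: ltW; apply: le_lt_trans SM.
  rewrite -(subrK (peval m (set_val x)) (f x)) (le_trans (ler_normD _ _))//.
  by apply: lerD; [exact: gM|exact/mB/unit_cube_val].
pose K := (2 `^ p * ((2 ^ d)%:R * S)) `^ p^-1.
apply: (@le_lt_trans _ _ K%:E); last exact: ltry.
apply/ereal_supP => _ [pi piP <-]; have [pifin picube _] := piP.
have cube0 : cube_pt R d.
  by apply: (exist _ (0 : 'rV[R]_d)); apply: mem_set => i; rewrite mxE; lra.
have pick Q : exists x : cube_pt R d, pi Q -> [/\ Q (set_val x),
    (0 <= approx_error k f Q)%E &
    (approx_error k f Q <= (2 * `|g x|)%:E)%E].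
  have [/picube[/is_cubeP[a [r [r0 ->]]] bu]|nQ] := pselect (pi Q).
    have [x xb Ex] := approx_error_le_twice mk gM r0 bu.
    by exists x => _; split => //; exact: approx_error_ge0.
  by exists cube0.
pose x Q := projT1 (cid (pick Q)).
have xP Q : pi Q -> _ := projT2 (cid (pick Q)).
rewrite -poweR_EFin; apply: gt0_ler_poweR.
- by rewrite invr_ge0 ltW.
- rewrite in_itv/= leey andbT; apply: fsume_ge0 => Q _; exact: poweR_ge0.
- by rewrite in_itv/= leey andbT lee_fin !mulr_ge0// powR_ge0.
rewrite fsbig_finite//=.
apply: (@le_trans _ _ (\sum_(Q <- finmap.enum_fset (fset_set pi))
    (2 `^ p * `|g (x Q)| `^ p)%:E)%E).
  rewrite big_seq [leRHS]big_seq; apply: lee_sum => Q.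
  rewrite in_fset_set// inE => /xP[_ E0 Eg].
  rewrite -powRM// -poweR_EFin; apply: gt0_ler_poweR => //.
  - exact: ltW.
  - by rewrite in_itv/= E0 leey.
  - by rewrite in_itv/= leey lee_fin mulr_ge0.
rewrite sumEFin lee_fin -mulr_sumr ler_wpM2l ?powR_ge0//.
apply: (sum_packing_le (F := fun y => `|g y| `^ p) piP) => //.
by move=> Q /xP[].
Qed.

(** The polynomial is the one that the punctured limits of [f] form, and the
    rest consists of the jumps of [f]. *)
Lemma V_space_decomposition (R : realType) (d k : nat) (p : R)
    (f : cube_pt R d -> R) : (0 < k)%N -> 1 <= p -> k%:R * p < d%:R ->
  V_space k p f -> exists2 m, @poly_space R d k m &
    lp_space p (fun x => f x - peval m (set_val x)).
Proof.
move=> k0 p1 kpd fV; have p0 : 0 < p by lra.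
have d2 : (2 <= d)%N.
  rewrite -(ltr_nat R); apply: le_lt_trans kpd.
  by rewrite -[1%:R]mulr1 ler_pM// ler1n.
have d0 : (0 < d)%N by exact: ltnW.
have [C FC] := V_space_variation p1 fV; have [M FM] := V_space_bounded fV.
have [G Gc FG] := regularization d2 k0 FC FM.
have GC := cube_variation_limit d0 FG FC.
have [m mk Gm] := polynomial_of_variation k0 p1 kpd GC Gc.
exists m => //; apply/(lp_spaceP _ p1); exists (2 `^ p * C) => r ur.
have tI : injective (tnth (in_tuple r)) by apply/tuple_uniqP.
have xI : injective (fun j => set_val (tnth (in_tuple r) j)).
  by move=> i j /set_val_inj /tI.
have := sum_jumps_le d0 FG FC xI (fun j => unit_cube_val _).
rewrite -(ler_pM2l (powR_gt0 p (ltr0n R 2))) mulr_sumr; apply: le_trans.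
rewrite big_tnth; apply: ler_sum => j _.
rewrite -powRM ?divr_ge0// mulrC divfK//.
by rewrite zero_extensionE Gm//; exact: unit_cube_val.
Qed.

Theorem theorem2p1 (R : realType) (d k : nat) (p : R)
    (d_gt0 : (0 < d)%N) (k_gt0 : (0 < k)%N) (p_ge1 : 1 <= p) :
  (forall f : cube_pt R d -> R, V_space k p f ->
     [/\ d = 1%N -> forall x, has_left_limit f x /\ has_right_limit f x,
         (2 <= d)%N -> forall x, has_limit f x
       & countable (discontinuities f)]) /\
  (let s := d%:R / p in
   k%:R < s ->
   is_direct_sum (@V_space R d k p) (@lp_space R d p) (@polynomial_funs R d k)).
Proof.
split=> [f fV|s ks].
  have [C FC] := V_space_variation p_ge1 fV; have [M FM] := V_space_bounded fV.
  split; last exact: countable_discontinuities fV.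
    move=> d1 x; pose o : 'I_d := Ordinal d_gt0.
    have lim s : s = 1 \/ s = -1 ->
        exists l, limit_along (zero_extension f) (half_space (set_val x) o s) (set_val x) l.
      move=> s1; apply: cauchy_limit_along => e e0.
      have [delta delta0 H] :=
        half_space_cauchy o k_gt0 FC FM (unit_cube_val x) s1 e0.
      by exists delta => // y z [yu ys] [zu zs] yx zx; exact: H.
    split.
      have [l xl] := lim (-1) (or_intror erefl); exists l.
      apply: limit_along_within xl => y yx; split; first exact: unit_cube_val.
      by have := yx o; lra.
    have [l xl] := lim 1 (or_introl erefl); exists l.
    apply: limit_along_within xl => y yx; split; first exact: unit_cube_val.
    by have := yx o; lra.
  move=> d2 x; have [l xl] := punctured_limit d2 k_gt0 FC FM (unit_cube_val x).
  exists l; apply: (limit_along_within _ xl) => y /= yx.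
  by split; [exact: unit_cube_val|rewrite (inj_eq (@set_val_inj R d))].
have p0 : 0 < p by lra.
have kpd : k%:R * p < d%:R by rewrite -ltr_pdivlMr.
have VE : @V_space R d k p =
    [set a + b | a in @lp_space R d p & b in @polynomial_funs R d k].
  apply/seteqP; split=> [f|_ [a al [_ [m mk <-] <-]]].
    move=> /(V_space_decomposition k_gt0 p_ge1 kpd)[m mk fm].
    exists (fun x => f x - peval m (set_val x)) => //.
    exists (fun x => peval m (set_val x)); first by exists m.
    by apply/funext => x; rewrite fctE subrK.
  apply: (V_space_lp_add_polynomial p_ge1 mk).
  by apply: eq_ind al _ _; apply/funext => x; rewrite fctE addrK.
have [A0 AL] := @lp_space_submod R d p p_ge1.
have [B0 BL] := @polynomial_funs_submod R d k.
split => //.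
- split=> [|c u v]; rewrite VE !inE.
    by exists 0; [rewrite inE in A0|exists 0; [rewrite inE in B0|rewrite addr0]].
  move=> [a al [b bp <-]] [a' a'l [b' b'p <-]].
  exists (c *: a + a').
    by have := AL c a a'; rewrite !inE; exact.
  exists (c *: b + b'); first by have := BL c b b'; rewrite !inE; exact.
  by rewrite scalerDr addrACA.
- apply/seteqP; split=> [f [fl fp]|_ ->].
    exact: lp_polynomial_eq0 fl fp.
  by split; [move: A0|move: B0]; rewrite inE.
Qed.
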